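(* In the setting and notation described in the context, let $(w,\boldsymbol p,u)\in H_0^1(\Omega)\times\boldsymbol H^1(\Omega;\mathbb R^2)/\boldsymbol{RM}^{\mathrm{rot}}\times H_0^1(\Omega)$ be the solution of the continuous decoupled Hellan–Herrmann–Johnson problem and $(w_h,\boldsymbol p_h,u_h)\in V_h\times\boldsymbol P_h/\boldsymbol{RM}^{\mathrm{rot}}\times V_h$ the solution of its discretization. Then $$\|\operatorname{sym}\mathbf{curl}(\boldsymbol p-\boldsymbol p_h)\|_0+\|\boldsymbol\sigma-\boldsymbol\sigma_h\|_0\lesssim\inf_{\boldsymbol q_h\in\boldsymbol P_h}\|\operatorname{sym}\mathbf{curl}(\boldsymbol p-\boldsymbol q_h)\|_0+\inf_{v_h\in V_h}|w-v_h|_1,$$ $$|u-u_h|_1\lesssim\inf_{v_h\in V_h}|u-v_h|_1+\inf_{\boldsymbol q_h\in\boldsymbol P_h}\|\operatorname{sym}\mathbf{curl}(\boldsymbol p-\boldsymbol q_h)\|_0+\inf_{v_h\in V_h}|w-v_h|_1.$$ Moreover, if for some $\delta\in(1/2,1]$ $$\|w-w_h\|_0\lesssim h^\delta|w-w_h|_1,\qquad\|\boldsymbol p-\boldsymbol p_h\|_0\lesssim h^\delta\|\operatorname{sym}\mathbf{curl}(\boldsymbol p-\boldsymbol p_h)\|_0,$$ then $$\|\operatorname{sym}\mathbf{curl}(\boldsymbol P_h^{cs}\boldsymbol p-\boldsymbol p_h)\|_0+\|\boldsymbol\sigma_h^\ast-\boldsymbol\sigma_h\|_0\lesssim h^\delta\inf_{v_h\in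 V_h}|w-v_h|_1,$$ $$|P_h^{\mathrm{grad}}u-u_h|_1\lesssim h^\delta\inf_{\boldsymbol q_h\in\boldsymbol P_h}\|\operatorname{sym}\mathbf{curl}(\boldsymbol p-\boldsymbol q_h)\|_0+h^\delta\inf_{v_h\in V_h}|w-v_h|_1.$$
   Context: $\Omega\subset\mathbb R^2$ is a bounded Lipschitz domain, simply connected with connected boundary; $f\in L^2(\Omega)$; $V_h\subset H_0^1(\Omega)$ and $\boldsymbol P_h\subset\boldsymbol H^1(\Omega;\mathbb R^2)$ are finite element (finite-dimensional) spaces on meshes of size $h$, and $\lesssim$ means $\le C\cdots$ with $C$ independent of $h$. $(\cdot,\cdot)$ and $\|\cdot\|_0$ are the $L^2$ inner product and norm, $|\cdot|_1$ the $H^1$ seminorm. $\operatorname{curl}v=(\partial_2v,-\partial_1v)^{\intercal}$; $\mathbf{curl}$ of a vector field is the matrix field whose rows are the curls of the components; $\operatorname{sym}\boldsymbol\tau=(\boldsymbol\tau+\boldsymbol\tau^{\intercal})/2$; $\boldsymbol\pi v=v\boldsymbol I_{2\times2}$. $\boldsymbol{RM}^{\mathrm{rot}}=\operatorname{span}\{(1,0)^{\intercal},(0,1)^{\intercal},\boldsymbol x\}$ is the kernel of $\operatorname{sym}\mathbf{curl}$; it is assumed contained in $\boldsymbol P_h$ so that the quotient makes sense, and classes modulo $\boldsymbol{RM}^{\mathrm{rot}}$ are identified with their representatives that are $L^2$-orthogonal to $\boldsymbol{RM}^{\mathrm{rot}}$. Continuous problem: find $w\in H_0^1(\Omega)$,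 $\boldsymbol p\in\boldsymbol H^1(\Omega;\mathbb R^2)/\boldsymbol{RM}^{\mathrm{rot}}$, $u\in H_0^1(\Omega)$ with $(\nabla w,\nabla v)=-(f,v)$ for all $v\in H_0^1(\Omega)$; $(\operatorname{sym}\mathbf{curl}\boldsymbol p,\operatorname{sym}\mathbf{curl}\boldsymbol q)=-(\boldsymbol\pi w,\operatorname{sym}\mathbf{curl}\boldsymbol q)$ for all $\boldsymbol q\in\boldsymbol H^1(\Omega;\mathbb R^2)/\boldsymbol{RM}^{\mathrm{rot}}$; $(\nabla u,\nabla\chi)=(\boldsymbol\sigma,\boldsymbol\pi\chi)$ for all $\chi\in H_0^1(\Omega)$, where $\boldsymbol\sigma=\operatorname{sym}\mathbf{curl}\boldsymbol p+\boldsymbol\pi w$. Discrete problem: the same three equations with $H_0^1(\Omega)$ replaced by $V_h$, $\boldsymbol H^1(\Omega;\mathbb R^2)$ replaced by $\boldsymbol P_h$ (trial and test spaces), unknowns $w_h,\boldsymbol p_h,u_h$, and $\boldsymbol\sigma_h=\operatorname{sym}\mathbf{curl}\boldsymbol p_h+\boldsymbol\pi w_h$. $\boldsymbol P_h^{cs}:\boldsymbol H^1(\Omega;\mathbb R^2)\to\boldsymbol P_h/\boldsymbol{RM}^{\mathrm{rot}}$ is defined by $(\operatorname{sym}\mathbf{curl}\boldsymbol P_h^{cs}\boldsymbol p,\operatorname{sym}\mathbf{curl}\boldsymbol q_h)=(\operatorname{sym}\mathbf{curl}\boldsymbol p,\operatorname{sym}\mathbf{curl}\boldsymbol q_h)$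 for all $\boldsymbol q_h\in\boldsymbol P_h/\boldsymbol{RM}^{\mathrm{rot}}$; $P_h^{\mathrm{grad}}$ is the $H^1$-orthogonal projection onto $V_h$, i.e. $(\nabla P_h^{\mathrm{grad}}u,\nabla\chi_h)=(\nabla u,\nabla\chi_h)$ for all $\chi_h\in V_h$; $\boldsymbol\sigma_h^\ast=\operatorname{sym}\mathbf{curl}\boldsymbol P_h^{cs}\boldsymbol p+\boldsymbol\pi w_h$. *)

(* Defs.v *)
From HB Require Import structures.
From mathcomp Require Import all_boot all_order all_algebra.
From mathcomp Require Import all_classical all_reals all_analysis.
Set Implicit Arguments.
Unset Strict Implicit.
Unset Printing Implicit Defensive.
Import Order.TTheory GRing.Theory Num.Theory numFieldNormedType.Exports.
Local Open Scope classical_set_scope.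
Local Open Scope ring_scope.

Section plane.
Variable R : realType.
Local Notation plane := (R * R)%type.
(* The same carrier as [plane], with the measurable structure that the product
   of two Lebesgue measures lives on. *)
Local Notation mplane := (measurableTypeR R * measurableTypeR R)%type.
Implicit Types (Omega : set plane).

Definition leb2 : {measure set mplane -> \bar R} :=
  (@lebesgue_measure R \x @lebesgue_measure R)%E.

Definition coord (i : 'I_2) (x : plane) : R := if i == 0 then x.1 else x.2.
Definition unitv (i : 'I_2) : plane := if i == 0 then (1, 0) else (0, 1).

(** ** Domains *)

Definition boundary (A : set plane) : set plane := closure A `\` interior A.

(* Around each boundary point x there is a direct orthonormal frame in which
   Omega is, locally, the strict epigraph of a Lipschitz function.  Reflected
   frames need no separate treatment: they amount to replacing g by
   t |-> g (- t). *)
Definition lipschitz_boundary Omega :=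
  forall x : plane, boundary Omega x ->
  exists (a b : R) (g : R -> R) (r : R),
    [/\ a ^+ 2 + b ^+ 2 = 1, lipschitz g, 0 < r &
      forall y : plane, ball x r y ->
        (Omega y <-> g (a * (y.1 - x.1) + b * (y.2 - x.2))
                     < a * (y.2 - x.2) - b * (y.1 - x.1))].

Definition bounded_lipschitz_domain Omega :=
  [/\ Omega !=set0, open Omega, connected Omega, bounded_set Omega &
      lipschitz_boundary Omega].

Definition path_connected (A : set plane) :=
  forall x y, A x -> A y -> exists g : R -> plane,
    [/\ {within `[0, 1], continuous g}, (forall t, 0 <= t <= 1 -> A (g t)),
        g 0 = x & g 1 = y].

Definition simply_connected (A : set plane) :=
  path_connected A /\
  forall g : R -> plane,
    {within `[0, 1], continuous g} -> (forall t, 0 <= t <= 1 -> A (g t)) ->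
    g 0 = g 1 ->
  exists H : R * R -> plane,
    [/\ {within `[0, 1] `*` `[0, 1], continuous H},
        (forall s t, 0 <= s <= 1 -> 0 <= t <= 1 -> A (H (s, t))),
        (forall t, 0 <= t <= 1 -> H (0, t) = g t /\ H (1, t) = g 0) &
        (forall s, 0 <= s <= 1 -> H (s, 0) = g 0 /\ H (s, 1) = g 0)].

(** ** Square integrable fields *)

(* Functions are representatives defined on the whole plane; every notion below
   depends only on their almost everywhere class on Omega. *)
Definition L2 Omega (u : plane -> R) :=
  measurable_fun (Omega : set mplane) u /\
  leb2.-integrable Omega (EFin \o (fun x => u x ^+ 2)).

Definition dot0 Omega (u v : plane -> R) : R :=
  \int[leb2]_(x in Omega) (u x * v x).
Definition norm0 Omega (u : plane -> R) : R := Num.sqrt (dot0 Omega u u).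

Definition dotmx Omega m n (F G : plane -> 'M[R]_(m, n)) : R :=
  \int[leb2]_(x in Omega) (\sum_i \sum_j F x i j * G x i j).
Definition normmx Omega m n (F : plane -> 'M[R]_(m, n)) : R :=
  Num.sqrt (dotmx Omega F F).

(** ** Sobolev spaces *)

Definition partial (i : 'I_2) (phi : plane -> R) : plane -> R :=
  fun x => 'D_(unitv i) phi x.

Fixpoint Ck (k : nat) (phi : plane -> R) : Prop :=
  continuous phi /\
  (if k is k'.+1 then
     forall i, (forall x, derivable phi x (unitv i)) /\ Ck k' (partial i phi)
   else True).

Definition support (phi : plane -> R) : set plane :=
  closure [set x | phi x != 0].

(* C_c^oo(Omega) *)
Definition test_function Omega (phi : plane -> R) :=
  [/\ forall k, Ck k phi, compact (support phi) & support phi `<=` Omega].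

Definition is_weak_partial Omega (i : 'I_2) (u g : plane -> R) :=
  L2 Omega g /\
  forall phi, test_function Omega phi ->
    dot0 Omega u (partial i phi) = - dot0 Omega g phi.

(* A representative of the weak derivative, which is unique almost everywhere
   on Omega; the value 0 is a junk default, not used on H^1(Omega). *)
Definition wpartial Omega (i : 'I_2) (u : plane -> R) : plane -> R :=
  xget (fun=> 0) (is_weak_partial Omega i u).

Definition H1 Omega : set (plane -> R) :=
  [set u | L2 Omega u /\ forall i, exists g, is_weak_partial Omega i u g].

Definition grad Omega (u : plane -> R) : plane -> 'cV[R]_2 :=
  fun x => \col_i wpartial Omega i u x.

Definition seminorm1 Omega (u : plane -> R) : R := normmx Omega (grad Omega u).
Definition norm1 Omega (u : plane -> R) : R :=
  Num.sqrt (norm0 Omega u ^+ 2 + seminorm1 Omega u ^+ 2).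

(* The closure of C_c^oo(Omega) in H^1(Omega). *)
Definition H10 Omega : set (plane -> R) :=
  [set u | H1 Omega u /\ forall e : R, 0 < e ->
     exists phi, test_function Omega phi /\ norm1 Omega (u - phi) < e].

Definition H1vec Omega : set (plane -> 'cV[R]_2) :=
  [set q | forall i, H1 Omega (fun x => q x i 0)].

(** ** Differential operators *)

Definition curl Omega (v : plane -> R) : plane -> 'cV[R]_2 :=
  fun x => \col_i (if i == 0 then wpartial Omega 1 v x
                   else - wpartial Omega 0 v x).

Definition curlmx Omega (q : plane -> 'cV[R]_2) : plane -> 'M[R]_2 :=
  fun x => \matrix_(i, j) curl Omega (fun y => q y i 0) x j 0.

Definition sym (t : 'M[R]_2) : 'M[R]_2 := 2^-1 *: (t + t^T).

Definition symcurl Omega (q : plane -> 'cV[R]_2) : plane -> 'M[R]_2 :=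
  fun x => sym (curlmx Omega q x).

Definition pimx (v : plane -> R) : plane -> 'M[R]_2 := fun x => (v x)%:M.

Definition RMrot : set (plane -> 'cV[R]_2) :=
  [set r | exists a b c : R, r = fun x =>
     a *: delta_mx 0 0 + b *: delta_mx 1 0 + c *: (\col_i coord i x)].

(* X / RM^rot: each class is represented by its element that is L^2-orthogonal
   to RM^rot. *)
Definition quoRM Omega (X : set (plane -> 'cV[R]_2)) :
    set (plane -> 'cV[R]_2) :=
  [set q | X q /\ forall r, RMrot r -> dotmx Omega q r = 0].

(** ** The decoupled Hellan-Herrmann-Johnson problem *)

(* V is a finite-dimensional linear subspace of X, functions being identified
   when they agree almost everywhere on Omega. *)
Definition fin_dim_subspace Omega (U : lmodType R) (X V : set (plane -> U)) :=
  exists (n : nat) (b : 'I_n -> plane -> U),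
    (forall j, X (b j)) /\
    V = [set v | X v /\ exists a : 'I_n -> R,
           \forall x \ae leb2, Omega x -> v x = \sum_j a j *: b j x].

Definition sigma Omega (p : plane -> 'cV[R]_2) (w : plane -> R) :
    plane -> 'M[R]_2 := symcurl Omega p + pimx w.

(* The continuous problem is the case V = H10 Omega, P = H1vec Omega; the
   discrete one is V = V_h, P = P_h. *)
Definition HHJ_solution Omega (f : plane -> R)
    (V : set (plane -> R)) (P : set (plane -> 'cV[R]_2))
    (w : plane -> R) (p : plane -> 'cV[R]_2) (u : plane -> R) :=
  [/\ V w, quoRM Omega P p & V u] /\
  [/\ forall v, V v ->
        dotmx Omega (grad Omega w) (grad Omega v) = - dot0 Omega f v,
      forall q, quoRM Omega P q ->
        dotmx Omega (symcurl Omega p) (symcurl Omega q) =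
        - dotmx Omega (pimx w) (symcurl Omega q) &
      forall chi, V chi ->
        dotmx Omega (grad Omega u) (grad Omega chi) =
        dotmx Omega (sigma Omega p w) (pimx chi)].

(* r = P_h^{cs} p *)
Definition is_Pcs Omega (P : set (plane -> 'cV[R]_2))
    (p r : plane -> 'cV[R]_2) :=
  quoRM Omega P r /\
  forall q, quoRM Omega P q ->
    dotmx Omega (symcurl Omega r) (symcurl Omega q) =
    dotmx Omega (symcurl Omega p) (symcurl Omega q).

(* z = P_h^{grad} u *)
Definition is_Pgrad Omega (V : set (plane -> R)) (u z : plane -> R) :=
  V z /\
  forall chi, V chi ->
    dotmx Omega (grad Omega z) (grad Omega chi) =
    dotmx Omega (grad Omega u) (grad Omega chi).

(* A family of pairs of discrete spaces, indexed by the meshes i : I, where h i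
   is the size of the mesh i. *)
Definition fe_spaces Omega (I : Type) (h : I -> R)
    (V : I -> set (plane -> R)) (P : I -> set (plane -> 'cV[R]_2)) :=
  forall i, [/\ 0 < h i,
    fin_dim_subspace Omega (H10 Omega) (V i),
    fin_dim_subspace Omega (H1vec Omega) (P i) & RMrot `<=` P i].

End plane.

(* Main.v *)
From Pilot Require Import Defs.
From HB Require Import structures.
From mathcomp Require Import all_boot all_order all_algebra.
From mathcomp Require Import all_classical all_reals all_analysis.
From mathcomp Require Import measurable_realfun ring lra.

Import Order.TTheory GRing.Theory Num.Theory numFieldNormedType.Exports.
Import Pilot.Defs.
Set Implicit Arguments.
Unset Strict Implicit.
Unset Printing Implicit Defensive.
Local Open Scope classical_set_scope.
Local Open Scope ring_scope.

(** The argument is that of Cea and Strang, applied to the three equations in turn.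
    The discrete spaces are conforming, so that subtracting the discrete equations
    from the continuous ones leaves:
    - for w, Galerkin orthogonality (eq_w), hence quasi-optimality of w_h;
    - for p, a residual - (pi (w - w_h), sym curl q_h) (eq_p), bounded by the L^2 norm
      of w - w_h, hence by Poincare's inequality (poincare) by the error on w in the
      energy norm; the quotient by RM^rot is harmless since sym curl vanishes on it
      (quoRM_representative);
    - for u, a residual (sigma - sigma_h, pi chi_h) (eq_u).
    Testing with the difference between the discrete solution and a competitor gives
    the first two estimates (cea_strang). The differences between the discrete
    solution and the projections P_h^cs p and P_h^grad u see the residuals alone
    (projection_error). For p the residual is of higher order as soon as the L^2 norm
    of w - w_h is. For u, it also contains (sym curl (p - p_h), pi chi_h): the trace
    of sym curl is a rotated divergence, so that integrating by parts against
    chi_h in H^1_0 (H1_H10_by_parts, symcurl_pimx_le) bounds this term by the L^2 norm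
    of p - p_h, again of higher order.

    These are computations with the linear operators grad and sym curl, but weak
    derivatives are given as chosen representatives. They are linear up to null sets
    because an L^2 function orthogonal to all test functions vanishes almost
    everywhere (L2_test_eq0). This is proved by letting explicit smooth bumps tend to
    indicators of boxes, and by extending the vanishing of the integrals from boxes to
    all measurable sets. Poincare's inequality and the integration by parts come from
    test functions by density; for these, the weak derivatives are the classical ones
    (integral_by_parts, by Fubini and the fundamental theorem of calculus). *)

(** * Square integrable fields *)

Lemma ord2P (i : 'I_2) : i = 0 \/ i = 1.
Proof. by case: i => [[|[|//]]] ?; [left|right]; apply/val_inj. Qed.

(** The measurable structure under leb2 is not the one inferred on R * R, so that
    instance resolution needs help. *)
#[global] Instance ae_leb2_filter (R : realType) :
  Filter (almost_everywhere (@leb2 R)) := ae_filter_ringOfSetsType (@leb2 R).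

Section square_integrable.
Context {R : realType}.
Local Notation plane := (R * R)%type.
Local Notation mplane := (measurableTypeR R * measurableTypeR R)%type.
Local Notation leb2 := (@leb2 R).
Variable Omega : set plane.
Hypothesis mOmega : measurable (Omega : set mplane).

Definition intg (u : plane -> R) := leb2.-integrable Omega (EFin \o u).

Lemma intgD u v : intg u -> intg v -> intg (fun x => u x + v x).
Proof. by move=> iu iv; rewrite /intg; exact: (integrableD mOmega iu iv). Qed.

Lemma intgZ a u : intg u -> intg (fun x => a * u x).
Proof. by move=> iu; rewrite /intg; exact: (integrableZl mOmega a iu). Qed.

Lemma intg_sum (I : Type) (r : seq I) (u : I -> plane -> R) :
  (forall i, intg (u i)) -> intg (fun x => \sum_(i <- r) u i x).
Proof.
move=> iu; elim: r => [|i r ih].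
  under [X in intg X]funext => x do rewrite big_nil.
  exact: integrable0.
under [X in intg X]funext => x do rewrite big_cons.
exact: intgD.
Qed.

Lemma integralD2 u v : intg u -> intg v ->
  \int[leb2]_(x in Omega) (u x + v x) =
  \int[leb2]_(x in Omega) u x + \int[leb2]_(x in Omega) v x.
Proof. exact: RintegralD. Qed.

(** By 2 |uv| <= u^2 + v^2. *)
Lemma L2M u v : L2 Omega u -> L2 Omega v -> intg (fun x => u x * v x).
Proof.
move=> [mu iu] [mv iv].
apply: (le_integrable mOmega (g := EFin \o (fun x => u x ^+ 2 + v x ^+ 2))).
- by apply/measurable_EFinP; exact: measurable_funM.
- move=> x _ /=; rewrite lee_fin normrM [leRHS]ger0_norm ?addr_ge0 ?sqr_ge0//.
  rewrite -(real_normK (num_real (u x))) -(real_normK (num_real (v x))).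
  have := sqr_ge0 (`|u x| - `|v x|).
  have := mulr_ge0 (normr_ge0 (u x)) (normr_ge0 (v x)).
  set a := `|u x|; set b := `|v x|; nra.
- exact: intgD.
Qed.

Lemma L2D u v : L2 Omega u -> L2 Omega v -> L2 Omega (u + v).
Proof.
move=> Lu Lv; split; first by apply: measurable_funD; [case: Lu|case: Lv].
rewrite (_ : (fun x => _) =
    (fun x => (u x ^+ 2 + v x ^+ 2) + 2 * (u x * v x))).
  apply: intgD; last exact/intgZ/L2M.
  by apply: intgD; [case: Lu|case: Lv].
by apply/funext => x; rewrite !fctE/=; ring.
Qed.

Lemma L2Z a u : L2 Omega u -> L2 Omega (a *: u).
Proof.
move=> [mu iu]; split; first exact: measurable_funM.
rewrite (_ : (fun x => _) = (fun x => a ^+ 2 * u x ^+ 2)); first exact: intgZ.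
by apply/funext => x; rewrite !fctE/= exprMn.
Qed.

Lemma L2N u : L2 Omega u -> L2 Omega (- u).
Proof. by rewrite -scaleN1r; exact: L2Z. Qed.

Lemma L2B u v : L2 Omega u -> L2 Omega v -> L2 Omega (u - v).
Proof. by move=> Lu Lv; apply: L2D => //; exact: L2N. Qed.

Lemma L2_0 : L2 Omega (fun=> 0).
Proof.
split; first exact: measurable_cst.
rewrite (_ : (fun x => _) = (fun=> 0)); first exact: integrable0.
by apply/funext => x; rewrite expr0n.
Qed.

Definition aeq (T : Type) (F G : plane -> T) :=
  \forall x \ae leb2, Omega x -> F x = G x.

Lemma aeq_refl T (F : plane -> T) : aeq F F.
Proof. exact: aeW. Qed.

Lemma aeq_sym T (F G : plane -> T) : aeq F G -> aeq G F.
Proof. by apply: filterS => x + Ox => ->. Qed.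

Lemma aeq_comp T U (k : T -> U) (F G : plane -> T) :
  aeq F G -> aeq (fun x => k (F x)) (fun x => k (G x)).
Proof. by apply: filterS => x FG Ox; rewrite FG. Qed.

Section matrix_fields.
Context {m n : nat}.
Implicit Types F G H : plane -> 'M[R]_(m, n).

Definition L2mx F := forall i j, L2 Omega (fun x => F x i j).

Lemma L2mx0 : L2mx 0.
Proof.
move=> i j; rewrite (_ : (fun x => _) = fun=> 0); first exact: L2_0.
by apply/funext => x; rewrite mxE.
Qed.

Lemma L2mxD F G : L2mx F -> L2mx G -> L2mx (F + G).
Proof.
move=> LF LG i j; rewrite (_ : (fun x => _) =
  (fun x => F x i j) + (fun x => G x i j)); first exact: L2D.
by apply/funext => x; rewrite !fctE mxE.
Qed.

Lemma L2mxZ a F : L2mx F -> L2mx (a *: F).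
Proof.
move=> LF i j; rewrite (_ : (fun x => _) = a *: (fun x => F x i j)).
  exact: L2Z.
by apply/funext => x; rewrite !fctE mxE.
Qed.

Lemma L2mxB F G : L2mx F -> L2mx G -> L2mx (F - G).
Proof.
by move=> LF LG; rewrite -scaleN1r; apply: L2mxD => //; exact: L2mxZ.
Qed.

Lemma intg_dotmx F G : L2mx F -> L2mx G ->
  intg (fun x => \sum_i \sum_j F x i j * G x i j).
Proof.
by move=> LF LG; apply: intg_sum => i; apply: intg_sum => j; exact: L2M.
Qed.

Lemma dotmxC F G : dotmx Omega F G = dotmx Omega G F.
Proof.
apply: eq_Rintegral => x _; apply: eq_bigr => i _; apply: eq_bigr => j _.
exact: mulrC.
Qed.

Lemma dotmxDl F G H : L2mx F -> L2mx G -> L2mx H ->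
  dotmx Omega (F + G) H = dotmx Omega F H + dotmx Omega G H.
Proof.
move=> LF LG LH; rewrite /dotmx -integralD2; [|exact: intg_dotmx..].
apply: eq_Rintegral => x _; rewrite -big_split; apply: eq_bigr => i _.
by rewrite -big_split; apply: eq_bigr => j _; rewrite !fctE mxE mulrDl.
Qed.

Lemma dotmxZl a F H : L2mx F -> L2mx H ->
  dotmx Omega (a *: F) H = a * dotmx Omega F H.
Proof.
move=> LF LH; rewrite /dotmx -RintegralZl//; last exact: intg_dotmx.
apply: eq_Rintegral => x _; rewrite mulr_sumr; apply: eq_bigr => i _.
by rewrite mulr_sumr; apply: eq_bigr => j _; rewrite !fctE mxE mulrA.
Qed.

Lemma dotmx0r F : L2mx F -> dotmx Omega F 0 = 0.
Proof.
move=> LF; rewrite dotmxC -[X in dotmx _ X _](scale0r (0 : plane -> 'M[R]_(m, n))).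
by rewrite dotmxZl ?mul0r//; exact: L2mx0.
Qed.

Lemma dotmxBl F G H : L2mx F -> L2mx G -> L2mx H ->
  dotmx Omega (F - G) H = dotmx Omega F H - dotmx Omega G H.
Proof.
move=> LF LG LH; rewrite -scaleN1r dotmxDl//; last exact: L2mxZ.
by rewrite dotmxZl// mulN1r.
Qed.

Lemma dotmxDr F G H : L2mx F -> L2mx G -> L2mx H ->
  dotmx Omega H (F + G) = dotmx Omega H F + dotmx Omega H G.
Proof. by move=> LF LG LH; rewrite !(dotmxC H) dotmxDl. Qed.

Lemma dotmxZr a F H : L2mx F -> L2mx H ->
  dotmx Omega H (a *: F) = a * dotmx Omega H F.
Proof. by move=> LF LH; rewrite !(dotmxC H) dotmxZl. Qed.

Lemma dotmx_ge0 F : 0 <= dotmx Omega F F.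
Proof.
apply: Rintegral_ge0 => x _.
by apply: sumr_ge0 => i _; apply: sumr_ge0 => j _; rewrite -expr2 sqr_ge0.
Qed.

Lemma normmx_ge0 F : 0 <= normmx Omega F.
Proof. exact: sqrtr_ge0. Qed.

Lemma normmx_sqr F : normmx Omega F ^+ 2 = dotmx Omega F F.
Proof. by rewrite sqr_sqrtr// dotmx_ge0. Qed.

(** Nonnegativity of the quadratic polynomial t |-> (F + tG, F + tG), read at
    its minimum, or far out when it is affine. *)
Lemma cauchy_schwarz F G : L2mx F -> L2mx G ->
  `|dotmx Omega F G| <= normmx Omega F * normmx Omega G.
Proof.
move=> LF LG; rewrite -sqrtr_sqr /normmx -sqrtrM ?dotmx_ge0//.
rewrite ler_wsqrtr//.
have quad t : 0 <= dotmx Omega F F + 2 * t * dotmx Omega F G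
                   + t ^+ 2 * dotmx Omega G G.
  have := dotmx_ge0 (F + t *: G).
  have LtG := L2mxZ t LG.
  rewrite dotmxDl//; last exact: L2mxD.
  by rewrite !dotmxDr// !dotmxZl// !dotmxZr// (dotmxC G F) => h; nra.
have a0 := dotmx_ge0 F; have c0 := dotmx_ge0 G; move: quad a0 c0.
set a := dotmx _ F F; set b := dotmx _ F G; set c := dotmx _ G G.
move=> quad a0; rewrite le_eqVlt => /predU1P[c0|c0].
  rewrite -c0 mulr0; have [-> |b0] := eqVneq b 0; first by rewrite expr0n.
  have := quad (- (a + 1) / (2 * b)); rewrite -c0 mulr0 addr0.
  rewrite (_ : 2 * _ * b = - (a + 1)); last by field.
  by move=> h; exfalso; lra.
have := quad (- b / c).
rewrite (_ : a + _ + _ = (a * c - b ^+ 2) / c); last first.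
  by field; rewrite gt_eqF.
by rewrite pmulr_lge0 ?invr_gt0// subr_ge0.
Qed.

Lemma dotmx_le F G : L2mx F -> L2mx G ->
  dotmx Omega F G <= normmx Omega F * normmx Omega G.
Proof.
by move=> LF LG; apply: le_trans (cauchy_schwarz LF LG); exact: ler_norm.
Qed.

Lemma normmxD F G : L2mx F -> L2mx G ->
  normmx Omega (F + G) <= normmx Omega F + normmx Omega G.
Proof.
move=> LF LG; have := dotmx_le LF LG; have := normmx_sqr (F + G).
rewrite dotmxDl//; last exact: L2mxD.
rewrite !dotmxDr// (dotmxC G F) -!normmx_sqr.
have := normmx_ge0 F; have := normmx_ge0 G; have := normmx_ge0 (F + G).
by move: (normmx _ _) (normmx _ _) (normmx _ _) => a b c; nra.
Qed.

Lemma normmxZ a F : L2mx F -> normmx Omega (a *: F) = `|a| * normmx Omega F.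
Proof.
move=> LF; rewrite /normmx dotmxZl//; last exact: L2mxZ.
by rewrite dotmxZr// mulrA -expr2 sqrtrM ?sqr_ge0// sqrtr_sqr.
Qed.

Lemma normmxBC F G : normmx Omega (F - G) = normmx Omega (G - F).
Proof.
congr Num.sqrt; apply: eq_Rintegral => x _.
apply: eq_bigr => i _; apply: eq_bigr => j _.
by rewrite !fctE !mxE; ring.
Qed.

Lemma dotmx_aeq F G H : L2mx F -> L2mx G -> L2mx H -> aeq F G ->
  dotmx Omega F H = dotmx Omega G H.
Proof.
move=> LF LG LH FG; congr fine; apply: ae_eq_integral => //.
- exact: measurable_int (intg_dotmx LF LH).
- exact: measurable_int (intg_dotmx LG LH).
- by move: FG; apply: filterS => x FG Ox /=; rewrite FG.
Qed.

Lemma normmx_aeq F G : L2mx F -> L2mx G -> aeq F G ->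
  normmx Omega F = normmx Omega G.
Proof.
move=> LF LG FG; rewrite /normmx; congr Num.sqrt.
by rewrite (dotmx_aeq LF LG)// dotmxC (dotmx_aeq LF LG).
Qed.

Definition projectable (K : set (plane -> 'M[R]_(m, n))) :=
  forall F, L2mx F ->
    exists2 G, K G & forall H, K H -> dotmx Omega (F - G) H = 0.

(** One Gram-Schmidt step. When the new direction e' has norm zero it is
    orthogonal to everything by Cauchy-Schwarz, and the division by zero, whose
    value is 0, leaves the projection unchanged. *)
Lemma projectable_addline (K : set (plane -> 'M[R]_(m, n))) e :
  K `<=` L2mx -> (forall a G H, K G -> K H -> K (G + a *: H)) -> L2mx e ->
  projectable K -> projectable [set G + a *: e | G in K & a in [set: R]].
Proof.
move=> LK KD Le projK F LF.
have [Pe KPe Peo] := projK _ Le; have [PF KPF PFo] := projK _ LF.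
have LPe := LK _ KPe; have LPF := LK _ KPF.
set e' := e - Pe; set F' := F - PF.
have Le' : L2mx e' by exact: L2mxB.
have LF' : L2mx F' by exact: L2mxB.
pose c := dotmx Omega F' e' / dotmx Omega e' e'.
have ce' : c * dotmx Omega e' e' = dotmx Omega F' e'.
  have [e0|e0] := eqVneq (dotmx Omega e' e') 0; last by rewrite divfK.
  rewrite e0 mulr0; apply/esym/eqP; rewrite -normr_le0.
  apply: le_trans (cauchy_schwarz LF' Le') _.
  by rewrite {2}/normmx e0 sqrtr0 mulr0.
exists (PF - c *: Pe + c *: e).
  by exists (PF - c *: Pe); [rewrite -scaleNr; exact: KD|exists c].
move=> _ [k Kk [a _ <-]].
rewrite (_ : F - _ = F' - c *: e'); last first.
  rewrite /F' /e' scalerBr !opprD !opprK !addrA -!addrA.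
  by congr (_ + (_ + _)); rewrite addrC.
rewrite (_ : k + a *: e = (k + a *: Pe) + a *: e'); last first.
  by rewrite /e' scalerBr -addrA; congr (_ + _); rewrite addrC subrK.
have Kk' : K (k + a *: Pe) by exact: KD.
have Lk' := LK _ Kk'.
rewrite dotmxDr//; [|exact: L2mxZ|by apply: L2mxB => //; exact: L2mxZ].
rewrite dotmxZr//; last by apply: L2mxB => //; exact: L2mxZ.
rewrite (dotmxBl LF' (L2mxZ c Le') Lk') (dotmxBl LF' (L2mxZ c Le') Le').
have PFo' : dotmx Omega F' (k + a *: Pe) = 0 := PFo _ Kk'.
have Peo' : dotmx Omega e' (k + a *: Pe) = 0 := Peo _ Kk'.
by rewrite !dotmxZl// PFo' Peo' ce' mulr0 !subrr mulr0 addr0.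
Qed.

End matrix_fields.
(** Scalar functions as 1 x 1 fields, to inherit the bilinear theory above. *)
Definition mx1 (u : plane -> R) : plane -> 'M[R]_1 := fun x => const_mx (u x).

Lemma dot0E u v : dot0 Omega u v = dotmx Omega (mx1 u) (mx1 v).
Proof. by apply: eq_Rintegral => x _; rewrite !big_ord1 !mxE. Qed.

Lemma norm0E u : norm0 Omega u = normmx Omega (mx1 u).
Proof. by rewrite /norm0 dot0E. Qed.

Lemma L2_mx1 u : L2 Omega u -> L2mx (mx1 u).
Proof.
by move=> Lu i j; rewrite (_ : (fun x => _) = u)//; apply/funext => x; rewrite mxE.
Qed.

Lemma mx1D u v : mx1 (u + v) = mx1 u + mx1 v.
Proof. by apply/funext => x; apply/matrixP => i j; rewrite !fctE !mxE. Qed.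

Lemma mx1Z a u : mx1 (a *: u) = a *: mx1 u.
Proof. by apply/funext => x; apply/matrixP => i j; rewrite !fctE !mxE. Qed.

Lemma mx1B u v : mx1 (u - v) = mx1 u - mx1 v.
Proof. by apply/funext => x; apply/matrixP => i j; rewrite !fctE !mxE. Qed.

Lemma dot0C u v : dot0 Omega u v = dot0 Omega v u.
Proof. by rewrite !dot0E dotmxC. Qed.

Lemma dot0Dl u v t : L2 Omega u -> L2 Omega v -> L2 Omega t ->
  dot0 Omega (u + v) t = dot0 Omega u t + dot0 Omega v t.
Proof. by move=> Lu Lv Lt; rewrite !dot0E mx1D dotmxDl//; exact: L2_mx1. Qed.

Lemma dot0Zl a u v : L2 Omega u -> L2 Omega v ->
  dot0 Omega (a *: u) v = a * dot0 Omega u v.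
Proof. by move=> Lu Lv; rewrite !dot0E mx1Z dotmxZl//; exact: L2_mx1. Qed.

Lemma dot0Bl u v t : L2 Omega u -> L2 Omega v -> L2 Omega t ->
  dot0 Omega (u - v) t = dot0 Omega u t - dot0 Omega v t.
Proof. by move=> Lu Lv Lt; rewrite !dot0E mx1B dotmxBl//; exact: L2_mx1. Qed.

Lemma dot0_aeq u v t : L2 Omega u -> L2 Omega v -> L2 Omega t -> aeq u v ->
  dot0 Omega u t = dot0 Omega v t.
Proof.
move=> Lu Lv Lt uv; rewrite !dot0E; apply: dotmx_aeq; try exact: L2_mx1.
exact: (aeq_comp (fun r : R => const_mx r) uv).
Qed.

Lemma norm0_ge0 u : 0 <= norm0 Omega u.
Proof. exact: sqrtr_ge0. Qed.

Lemma norm0_sqr u : norm0 Omega u ^+ 2 = dot0 Omega u u.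
Proof. by rewrite norm0E normmx_sqr dot0E. Qed.

Lemma cauchy_schwarz0 u v : L2 Omega u -> L2 Omega v ->
  `|dot0 Omega u v| <= norm0 Omega u * norm0 Omega v.
Proof.
by move=> Lu Lv; rewrite dot0E !norm0E; apply: cauchy_schwarz; exact: L2_mx1.
Qed.

Lemma norm0D u v : L2 Omega u -> L2 Omega v ->
  norm0 Omega (u + v) <= norm0 Omega u + norm0 Omega v.
Proof. by move=> Lu Lv; rewrite !norm0E mx1D; apply: normmxD; exact: L2_mx1. Qed.

Lemma norm0_entry_le m n (F : plane -> 'M[R]_(m, n)) i j : L2mx F ->
  norm0 Omega (fun x => F x i j) <= normmx Omega F.
Proof.
move=> LF; apply: ler_wsqrtr; apply: le_Rintegral => //.
- exact: L2M.
- exact: intg_dotmx.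
- move=> x _; rewrite (bigD1 i)//= (bigD1 j)//= -addrA lerDl.
  apply: addr_ge0; first by apply: sumr_ge0 => k _; rewrite -expr2 sqr_ge0.
  by apply: sumr_ge0 => k _; apply: sumr_ge0 => l _; rewrite -expr2 sqr_ge0.
Qed.

End square_integrable.

(** * Boxes and continuous functions in the plane *)

Section plane_topology.
Context {R : realType}.
Local Notation plane := (R * R)%type.
Local Notation mplane := (measurableTypeR R * measurableTypeR R)%type.
Local Notation leb2 := (@leb2 R).

Definition obox (a b c d : R) : set plane := `]a, b[ `*` `]c, d[.
Definition cbox (a b c d : R) : set plane := `[a, b] `*` `[c, d].

Lemma measurable_obox a b c d : measurable (obox a b c d : set mplane).
Proof. by apply: measurableX; exact: measurable_itv. Qed.

Lemma measurable_cbox a b c d : measurable (cbox a b c d : set mplane).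
Proof. by apply: measurableX; exact: measurable_itv. Qed.

Lemma leb2_cbox a b c d : (leb2 (cbox a b c d) < +oo)%E.
Proof.
have -> : leb2 (cbox a b c d) =
    (lebesgue_measure (`[a, b] : set R) * lebesgue_measure (`[c, d] : set R))%E.
  by apply: product_measure1E; exact: measurable_itv.
rewrite !lebesgue_measure_itv.
by case: ifP => _; case: ifP => _;
  rewrite ?mul0e ?mule0//= -?EFinB -?EFinM ltry.
Qed.

Lemma obox_cbox a b c d : obox a b c d `<=` cbox a b c d.
Proof.
move=> x [/= + +]; rewrite !in_itv /=.
by move=> /andP[/ltW ? /ltW ?] /andP[/ltW ? /ltW ?]; split; rewrite /= in_itv/=;
  apply/andP.
Qed.

Lemma compact_cbox a b c d : compact (cbox a b c d).
Proof. by apply: compact_setX; exact: segment_compact. Qed.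

(** The default (1, 0, 1, 0) is an empty box. *)
Definition ratbox (n : nat) : R * R * R * R :=
  if @unpickle (rat * rat * rat * rat)%type n is Some (a, b, c, d)
  then (ratr a, ratr b, ratr c, ratr d) else (1, 0, 1, 0).

(** An open set is covered by the countably many rational boxes whose closure it
    contains: this makes it measurable for the product structure, and localizes
    almost everywhere statements to boxes. *)
Lemma open_ratbox (U : set plane) x : open U -> U x ->
  exists n, let: (a, b, c, d) := ratbox n in
    cbox a b c d `<=` U /\ obox a b c d x.
Proof.
move=> oU Ux; have /nbhs_ballP[e /= e0 eU] : nbhs x U by exact: open_nbhs_nbhs.
have rat_between (s t : R) : s < t -> exists q : rat, s < ratr q < t.
  by move=> /rat_in_itvoo[q]; rewrite in_itv => ?; exists q.
have [a /andP[a1 a2]] : exists a : rat, x.1 - e < ratr a < x.1.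
  by apply: rat_between; rewrite ltrBlDr ltrDl.
have [b /andP[b1 b2]] : exists b : rat, x.1 < ratr b < x.1 + e.
  by apply: rat_between; rewrite ltrDl.
have [c /andP[c1 c2]] : exists c : rat, x.2 - e < ratr c < x.2.
  by apply: rat_between; rewrite ltrBlDr ltrDl.
have [d /andP[d1 d2]] : exists d : rat, x.2 < ratr d < x.2 + e.
  by apply: rat_between; rewrite ltrDl.
exists (pickle (a, b, c, d)); rewrite /ratbox pickleK; split.
  move=> y [/= + +]; rewrite !in_itv/= => /andP[ya yb] /andP[yc yd].
  apply: eU; split; rewrite /ball/= ltr_norml; apply/andP; split; lra.
by split; rewrite /= in_itv/=; apply/andP.
Qed.

Lemma open_measurable_plane (U : set plane) : open U ->
  measurable (U : set mplane).
Proof.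
move=> oU; pose B n := let: (a, b, c, d) := ratbox n in
  if `[< cbox a b c d `<=` U >] then obox a b c d else set0.
rewrite (_ : U = \bigcup_n B n).
  apply: bigcupT_measurable => n; rewrite /B; case: (ratbox n) => [[[a b] c] d].
  by case: ifP => _ //; exact: measurable_obox.
apply/seteqP; split=> [x Ux|x [n _]].
  have [n] := open_ratbox oU Ux; case E : (ratbox n) => [[[a b] c] d] [abU ox].
  by exists n => //; rewrite /B E asboolT.
rewrite /B; case: (ratbox n) => [[[a b] c] d]; case: asboolP => // abU ox.
exact/abU/obox_cbox.
Qed.

Lemma continuous_measurable_plane (D : set plane) (f : plane -> R) :
  measurable (D : set mplane) -> continuous f ->
  measurable_fun (D : set mplane) f.
Proof.
move=> mD cf; apply: measurable_funTS.
move=> _; apply: (measurability _ (RGenOpens.measurableE R)).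
move=> _ [_ [a [b ->] <-]]; rewrite setTI; apply: open_measurable_plane.
by move/continuousP: cf; apply; exact: interval_open.
exact: measurableT.
Qed.

Lemma continuous_bounded_cbox (f : plane -> R) a b c d : continuous f ->
  exists M, forall x, cbox a b c d x -> `|f x| <= M.
Proof.
move=> cf; have : compact (f @` cbox a b c d).
  apply: continuous_compact; last exact: compact_cbox.
  exact: continuous_subspaceT.
move/compact_bounded => [M [_ Mf]]; exists (M + 1) => x Dx.
by apply: (Mf (M + 1)); [rewrite ltrDl|exists x].
Qed.

Lemma bounded_cbox (A : set plane) : bounded_set A ->
  exists2 M, 0 < M & A `<=` cbox (- M) M (- M) M.
Proof.
move=> [M [_ MA]]; exists (`|M| + 1); first by rewrite ltr_pwDr.
move=> x Ax; have : `|x| <= `|M| + 1.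
  by apply: MA => //; rewrite (le_lt_trans (ler_norm _))// ltrDl.
rewrite prod_normE ge_max => /andP[x1 x2].
by split; rewrite /= in_itv/= -ler_norml.
Qed.

Lemma continuous_integrable (D : set plane) (f : plane -> R) :
  measurable (D : set mplane) -> bounded_set D -> continuous f ->
  leb2.-integrable D (EFin \o f).
Proof.
move=> mD bD cf; have [M M0 DM] := bounded_cbox bD.
have [B fB] := continuous_bounded_cbox (- M) M (- M) M cf.
apply: measurable_bounded_integrable => //.
- apply: le_lt_trans (leb2_cbox (- M) M (- M) M).
  by apply: le_measure; rewrite ?inE//; exact: measurable_cbox.
- exact: continuous_measurable_plane.
- exists B; split; first exact: num_real.
  by move=> y By x Dx /=; apply: le_trans (ltW By); exact/fB/DM.
Qed.

Lemma L2_continuous (D : set plane) (f : plane -> R) :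
  measurable (D : set mplane) -> bounded_set D -> continuous f -> L2 D f.
Proof.
move=> mD bD cf; split; first exact: continuous_measurable_plane.
apply: continuous_integrable => // x.
by apply: continuousM; exact: cf.
Qed.

End plane_topology.

(** * Integration by parts against test functions *)

Section calculus.
Context {R : realType}.
Local Notation plane := (R * R)%type.
Local Notation mplane := (measurableTypeR R * measurableTypeR R)%type.
Local Notation leb2 := (@leb2 R).
Local Notation leb := (@lebesgue_measure R).

Lemma derive_vanish (V : normedModType R) (F : V -> R) x v :
  (\near x, F x = 0) -> 'D_v F x = 0.
Proof. by move=> F0; rewrite (near_eq_derive (g := cst 0))// derive_cst. Qed.

(** The fundamental theorem of calculus on a segment containing the support. *)
Lemma integral_derive_eq0 (g : R -> R) (M : R) : 0 < M ->
  (forall t : R, derivable g t 1) -> continuous (fun t : R => 'D_1 g t) ->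
  (forall t, M < `|t| -> g t = 0) ->
  (\int[leb]_t ('D_1 g t)%:E = 0)%E.
Proof.
move=> M0 dg cg gM.
have cont_g : continuous g.
  by move=> t; apply/differentiable_continuous/derivable1_diffP.
have g'M (t : R) : M < `|t| -> 'D_1 g t = 0.
  move=> Mt; apply: derive_vanish.
  have : \forall s \near t, M < `|s|.
    exact: (cvgr_gt _ (@norm_continuous _ _ t)).
  by apply: filterS => s; exact: gM.
pose N : R := M + 1.
pose D : set R := [set` `[- N, N]].
have -> : (\int[leb]_t ('D_1 g t)%:E = \int[leb]_(t in D) ('D_1 g t)%:E)%E.
  rewrite [RHS]integral_mkcond; apply: eq_integral => t _; rewrite patchE.
  case: ifPn => // /negP tN; rewrite g'M//; rewrite ltNge; apply/negP => tM.
  by apply: tN; rewrite inE /D/= in_itv/= -ler_norml (le_trans tM)// lerDl.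
rewrite /D (continuous_FTC2 (F := g)).
- rewrite !gM ?subee//; rewrite /N ?normrN gtr0_norm ?ltrDl//; lra.
- by rewrite /N; lra.
- exact: continuous_subspaceT.
- split; first by move=> t _.
  + by apply: cvg_at_right_filter; exact: cont_g.
  + by apply: cvg_at_left_filter; exact: cont_g.
- by move=> t _; rewrite derive1E.
Qed.

Lemma slice_continuous0 (y : R) : continuous (fun t : R => (t, y)).
Proof.
move=> t.
exact: (@cvg_pair _ _ _ _ (nbhs t) (nbhs y) _ _ _ _ _ cvg_id (cvg_cst _)).
Qed.

Lemma slice_continuous1 (x : R) : continuous (fun t : R => (x, t)).
Proof.
move=> t.
exact: (@cvg_pair _ _ _ _ (nbhs x) (nbhs t) _ _ _ _ _ (cvg_cst _) cvg_id).
Qed.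

Let slice0 (F : plane -> R) (x y : R) :
  (fun h : R => h^-1 *: (((fun t => F (t, y)) \o shift x) (h *: (1 : R)) - F (x, y)))
  = (fun h : R => h^-1 *: ((F \o shift (x, y)) (h *: unitv R 0) - F (x, y))).
Proof.
by apply/funext => h /=; congr (_ *: (F (_, _) - _)); rewrite /= scaler0 add0r.
Qed.

Lemma derive_slice0 (F : plane -> R) x y :
  'D_1 (fun t => F (t, y)) x = partial 0 F (x, y).
Proof. by rewrite /partial /derive slice0. Qed.

Lemma derivable_slice0 (F : plane -> R) x y :
  derivable F (x, y) (unitv R 0) -> derivable (fun t => F (t, y)) x 1.
Proof. by rewrite /derivable slice0. Qed.

Let slice1 (F : plane -> R) (x y : R) :
  (fun h : R => h^-1 *: (((fun t => F (x, t)) \o shift y) (h *: (1 : R)) - F (x, y)))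
  = (fun h : R => h^-1 *: ((F \o shift (x, y)) (h *: unitv R 1) - F (x, y))).
Proof.
by apply/funext => h /=; congr (_ *: (F (_, _) - _)); rewrite /= scaler0 add0r.
Qed.

Lemma derive_slice1 (F : plane -> R) x y :
  'D_1 (fun t => F (x, t)) y = partial 1 F (x, y).
Proof. by rewrite /partial /derive slice1. Qed.

Lemma derivable_slice1 (F : plane -> R) x y :
  derivable F (x, y) (unitv R 1) -> derivable (fun t => F (x, t)) y 1.
Proof. by rewrite /derivable slice1. Qed.

Lemma partial_support i (F : plane -> R) x :
  ~ support F x -> partial i F x = 0.
Proof.
move=> nFx; apply: derive_vanish.
have : nbhs x (~` support F).
  by apply: open_nbhs_nbhs; split => //; apply/closed_openC/closed_closure.
apply: filterS => y nFy; apply/eqP; apply: contrapT => /negP Fy; apply: nFy.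
exact: subset_closure.
Qed.

Lemma notin_support (F : plane -> R) x : ~ support F x -> F x = 0.
Proof.
move=> nFx; apply/eqP; apply: contrapT => /negP Fx; apply: nFx.
exact: subset_closure.
Qed.

(** Fubini, integrating first in the direction of the derivative. *)
Lemma integral_partial (F : plane -> R) i : Ck 1 F -> compact (support F) ->
  (\int[leb2]_x (partial i F x)%:E = 0)%E.
Proof.
move=> [cF dF] /compact_bounded/bounded_cbox[M M0 FM].
have [di [ci _]] := dF i.
have nF x : M < `|x.1| \/ M < `|x.2| -> ~ support F x.
  move=> h /FM[/=]; rewrite !in_itv/= -!ler_norml => x1 x2.
  by case: h; rewrite ltNge ?x1 ?x2.
have iF : leb2.-integrable setT (EFin \o partial i F).
  rewrite (_ : EFin \o _ = (EFin \o partial i F) \_ (cbox (- M) M (- M) M)).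
    apply/(integrable_mkcond _ (measurable_cbox _ _ _ _)).
    apply: continuous_integrable => //; first exact: measurable_cbox.
    exact/compact_bounded/compact_cbox.
  apply/funext => x; rewrite patchE; case: ifPn => // /negP xM /=.
  rewrite partial_support// => /FM xM'; apply: xM; exact: mem_set.
have [i0|i1] := ord2P i.
- rewrite i0 in di ci iF *.
  rewrite -(integral21_prod_meas1 iF) integral0_eq// => y _.
  rewrite /fubini_G/=; under eq_integral do rewrite -derive_slice0.
  apply: (integral_derive_eq0 M0).
  + by move=> t; apply: derivable_slice0.
  + rewrite (_ : (fun t => _) = partial 0 F \o (fun t => (t, y))).
      move=> t; apply: continuous_comp; last exact: ci.
      exact: slice_continuous0.
    by apply/funext => t /=; rewrite derive_slice0.
  + by move=> t tM; apply/notin_support/nF; left.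
- rewrite i1 in di ci iF *.
  rewrite -(integral12_prod_meas1 iF) integral0_eq// => x _.
  rewrite /fubini_F/=; under eq_integral do rewrite -derive_slice1.
  apply: (integral_derive_eq0 M0).
  + by move=> t; apply: derivable_slice1.
  + rewrite (_ : (fun t => _) = partial 1 F \o (fun t => (x, t))).
      move=> t; apply: continuous_comp; last exact: ci.
      exact: slice_continuous1.
    by apply/funext => t /=; rewrite derive_slice1.
  + by move=> t tM; apply/notin_support/nF; right.
Qed.

Lemma partialM i (u v : plane -> R) x :
  derivable u x (unitv R i) -> derivable v x (unitv R i) ->
  partial i (u * v) x = u x * partial i v x + partial i u x * v x.
Proof.
move=> du dv; rewrite /partial; have -> := deriveM du dv.
by congr (_ + _); exact: mulrC.
Qed.

Lemma Ck_continuous k (u : plane -> R) : Ck k u -> continuous u.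
Proof. by case: k => [|k] []. Qed.

Lemma CkW k (u : plane -> R) : Ck k.+1 u -> Ck k u.
Proof.
elim: k u => [|k ih] u [cu du]; first by split.
by split => // i; have [dui cui] := du i; split => //; exact: ih.
Qed.

Lemma CkD k (u v : plane -> R) : Ck k u -> Ck k v -> Ck k (u + v).
Proof.
elim: k u v => [|k ih] u v [cu du] [cv dv].
  by split=> // x; apply: continuousD; [exact: cu|exact: cv].
split=> [x|i]; first by apply: continuousD; [exact: cu|exact: cv].
have [dui cui] := du i; have [dvi cvi] := dv i.
split=> [x|]; first exact: derivableD.
rewrite (_ : partial i _ = partial i u + partial i v); first exact: ih.
by apply/funext => x; rewrite /partial deriveD.
Qed.

Lemma CkM k (u v : plane -> R) : Ck k u -> Ck k v -> Ck k (u * v).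
Proof.
elim: k u v => [|k ih] u v Cu Cv; have [cu du] := Cu; have [cv dv] := Cv.
  by split=> // x; apply: continuousM; [exact: cu|exact: cv].
split=> [x|i]; first by apply: continuousM; [exact: cu|exact: cv].
have [dui cui] := du i; have [dvi cvi] := dv i.
split=> [x|]; first exact: derivableM.
rewrite (_ : partial i _ = u * partial i v + partial i u * v).
  by apply: CkD; apply: ih => //; exact: CkW.
by apply/funext => x; rewrite partialM.
Qed.

Lemma support_mulr (u phi : plane -> R) :
  support (u * phi) `<=` support phi.
Proof.
apply: closure_subset => x /=; rewrite !fctE/= mulf_eq0 negb_or.
by case/andP.
Qed.

Variable Omega : set plane.
Hypothesis mOmega : measurable (Omega : set mplane).
Hypothesis bOmega : bounded_set Omega.

(** The product u phi has compact support in Omega, so its derivative integrates to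
    zero over Omega as well as over the plane. *)
Lemma integral_by_parts (u phi : plane -> R) i :
  Ck 1 u -> test_function Omega phi ->
  dot0 Omega u (partial i phi) = - dot0 Omega (partial i u) phi.
Proof.
move=> cu [cphi kphi sphi]; have c1phi := cphi 1%N.
have [cu0 du] := cu; have [cp0 dp] := c1phi.
have [dui [cui _]] := du i; have [dpi [cpi _]] := dp i.
have kup : compact (support (u * phi)).
  apply: subclosed_compact kphi _; first exact: closed_closure.
  exact: support_mulr.
have : \int[leb2]_(x in Omega) partial i (u * phi) x = 0.
  rewrite /Rintegral -[RHS]/(fine 0%E) -(integral_partial i (CkM cu c1phi) kup).
  congr fine; rewrite integral_mkcond; apply: eq_integral => x _; rewrite patchE.
  case: ifPn => // /negP xO; rewrite partial_support// => /support_mulr/sphi xO'.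
  exact/xO/mem_set.
rewrite (@eq_Rintegral _ _ _ leb2 Omega
    (fun x => u x * partial i phi x + partial i u x * phi x)); last first.
  by move=> x _; rewrite partialM.
rewrite RintegralD//.
- by move/eqP; rewrite addr_eq0 => /eqP.
- apply: (continuous_integrable mOmega bOmega) => x.
  by apply: continuousM; [exact: cu0|exact: cpi].
- apply: (continuous_integrable mOmega bOmega) => x.
  by apply: continuousM; [exact: cui|exact: cp0].
Qed.

Lemma Ck1_weak_partial (u : plane -> R) i :
  Ck 1 u -> is_weak_partial Omega i u (partial i u).
Proof.
move=> cu; split; last by move=> phi tphi; exact: integral_by_parts.
by have [_ /(_ i)[_ [ci _]]] := cu; exact: L2_continuous.
Qed.

Lemma Ck1_H1 (u : plane -> R) : Ck 1 u -> H1 Omega u.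
Proof.
move=> cu; split; first by apply: L2_continuous => //; case: cu.
by move=> i; exists (partial i u); exact: Ck1_weak_partial.
Qed.

End calculus.

(** * Smooth bumps *)

Section bump.
Context {R : realType}.
Local Notation plane := (R * R)%type.
Implicit Types (P : {poly R}) (t s : R).

(** The functions P(1/t) exp(-1/t), extended by zero to t <= 0, form a family closed
    under differentiation, so that the smoothness of exp(-1/t) is an induction over
    all P at once. *)
Definition flat P t : R := if 0 < t then P.[t^-1] * expR (- t^-1) else 0.

Definition flat_deriv P : {poly R} := 'X^2 * (P - P^`()).

(** From exp(s / n) >= s / n, raised to the power n. *)
Lemma exprn_expRN_le n s : 0 <= s -> s ^+ n * expR (- s) <= n%:R ^+ n.
Proof.
move=> s0; case: n => [|n].
  by rewrite !expr0 mul1r -[leRHS]expR0 ler_expR lerNl oppr0.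
have n0 : 0 < n.+1%:R :> R by rewrite ltr0n.
rewrite expRN ler_pdivrMr ?expR_gt0//.
rewrite (_ : expR s = expR (s / n.+1%:R) ^+ n.+1); last first.
  by rewrite -expRM_natl mulrC divfK// gt_eqF.
rewrite -exprMn ler_pXn2r// ?nnegrE ?mulr_ge0 ?expR_ge0//.
rewrite mulrC -ler_pdivrMr//.
by apply: le_trans (expR_ge1Dx _); rewrite lerDr.
Qed.

Lemma horner_expRN_bounded P :
  exists2 C, 0 <= C & forall s, 0 <= s -> `|P.[s] * expR (- s)| <= C.
Proof.
exists (\sum_(i < size P) `|P`_i| * i%:R ^+ i) => [|s s0].
  by apply: sumr_ge0 => i _; rewrite mulr_ge0// exprn_ge0.
rewrite horner_coef mulr_suml; apply: le_trans (ler_norm_sum _ _ _) _.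
apply: ler_sum => i _; rewrite -mulrA normrM ler_wpM2l//.
by rewrite ger0_norm ?exprn_expRN_le// mulr_ge0 ?expR_ge0// exprn_ge0.
Qed.

(** Near the origin flat P is dominated by t^2, hence has derivative zero there. *)
Lemma flat_le P : exists2 C, 0 <= C & forall t, `|flat P t| <= C * t ^+ 2.
Proof.
have [C C0 CP] := horner_expRN_bounded ('X^2 * P).
exists C => // t; rewrite /flat; case: ifPn => [t0|_]; last first.
  by rewrite normr0 mulr_ge0// sqr_ge0.
have := CP t^-1; rewrite invr_ge0 ltW// => /(_ isT).
rewrite hornerM hornerXn -mulrA normrM exprVn normfV (ger0_norm (sqr_ge0 t)).
by rewrite mulrC ler_pdivrMr// exprn_gt0.
Qed.

Lemma is_derive_flat P t : is_derive t 1 (flat P) (flat (flat_deriv P) t).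
Proof.
have [t0|t0|->] := ltgtP t 0.
- have -> : flat (flat_deriv P) t = 0 by rewrite /flat ltNge ltW.
  apply: (@near_eq_is_derive _ _ _ (cst 0)).
  near=> s; rewrite /flat ltNge ltW//; near: s; exact: lt_nbhsl.
- rewrite {2}/flat t0.
  apply: (@near_eq_is_derive _ _ _
      ((fun s => P.[s^-1]) * (fun s => expR (- s^-1)))).
    near=> s; rewrite /flat ifT//; near: s; exact: lt_nbhsr.
  have tn : t != 0 by rewrite gt_eqF.
  have dV : is_derive t 1 (fun s : R => s^-1) (- t ^- 2).
    have := @is_deriveV R id t 1 1 tn (is_derive_id t 1).
    by rewrite /GRing.scale/= mulr1.
  have dP : is_derive t 1 (fun s => P.[s^-1]) (P^`().[t^-1] * - t ^- 2).
    exact: (is_derive1_comp (is_derive_poly P t^-1) dV).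
  have dE : is_derive t 1 (fun s => expR (- s^-1)) (expR (- t^-1) * t ^- 2).
    have dN : is_derive t 1 (fun s : R => - s^-1) (t ^- 2).
      by have := is_deriveN dV; rewrite opprK.
    exact: (@is_derive1_comp R expR (fun s => - s^-1) t _ _ _ dN).
  apply: is_derive_eq (is_deriveM dP dE) _.
  rewrite /flat_deriv !hornerE exprVn.
  have key (a b c d : R) : a * (c * d) + c * (b * - d) = d * (a - b) * c by ring.
  exact: key.
- have -> : flat (flat_deriv P) 0 = 0 by rewrite /flat ltxx.
  have [C C0 CP] := flat_le P.
  have lim0 : (fun h : R => h^-1 *: ((flat P \o shift 0) (h *: 1) - flat P 0))
      @ 0^' --> (0 : R).
    apply/cvgrPdist_le => e e0; near=> h.
    rewrite sub0r normrN /= addr0 {2}/flat ltxx subr0 /GRing.scale/= mulr1.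
    have h0 : h != 0 by near: h; exact: nbhs_dnbhs_neq.
    rewrite normrM normfV ler_pdivrMl ?normr_gt0//.
    apply: le_trans (CP h) _; rewrite -(real_normK (num_real h)) expr2 mulrA.
    rewrite [leRHS]mulrC ler_wpM2r//; apply: (@le_trans _ _ ((C + 1) * `|h|)).
      by rewrite ler_wpM2r// lerDl.
    rewrite mulrC -ler_pdivlMr ?ltr_wpDl//; near: h.
    by apply: dnbhs0_le; rewrite divr_gt0// ltr_wpDl.
  split; first by apply/cvg_ex; exists 0.
  exact: cvg_lim.
Unshelve. all: by end_near.
Qed.

Lemma flat_continuous P : continuous (flat P).
Proof.
move=> t; apply/differentiable_continuous/derivable1_diffP.
by case: (is_derive_flat P t).
Qed.

Definition affine (a b c : R) (x : plane) : R := a * x.1 + b * x.2 + c.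

Lemma affine_continuous a b c : continuous (affine a b c).
Proof.
move=> x; apply: cvgD; last exact: cvg_cst.
by apply: cvgD; apply: cvgM;
  [exact: cvg_cst|exact: cvg_fst|exact: cvg_cst|exact: cvg_snd].
Qed.

(** The chain rule along a line: on x + hv the affine map is h |-> h m + const,
    with slope m. *)
Lemma affine_growth (f : R -> R) a b c (x v : plane) :
    (fun h : R => h^-1 *: (((f \o affine a b c) \o shift x) (h *: v)
                         - (f \o affine a b c) x))
  = (fun h : R => h^-1 *: ((f \o shift (affine a b c x)) (h *: (a * v.1 + b * v.2))
                           - f (affine a b c x))).
Proof.
apply/funext => h /=; congr (_ *: (f _ - _)).
case: x v => x1 x2 [v1 v2]; rewrite /affine /=.
have key (h' : R) : a * (h' * v1 + x1) + b * (h' * v2 + x2) + c =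
  h' * (a * v1 + b * v2) + (a * x1 + b * x2 + c) by ring.
exact: key.
Qed.

Lemma is_derive_affine (f : R -> R) a b c (x v : plane) (df : R) :
  is_derive (affine a b c x) 1 f df ->
  is_derive x v (f \o affine a b c) ((a * v.1 + b * v.2) * df).
Proof.
move=> [dfx dfE]; have difff : differentiable f (affine a b c x).
  exact/derivable1_diffP.
set m := _ + _; have dm : derivable f (affine a b c x) m by exact: diff_derivable.
split; first by rewrite /derivable affine_growth; exact: dm.
transitivity ('D_m f (affine a b c x)).
  by rewrite /derive affine_growth.
rewrite deriveE// (_ : m = m *: (1 : R)); last by rewrite /GRing.scale/= mulr1.
by rewrite linearZ -deriveE// dfE /GRing.scale/= mulr1.
Qed.

Lemma Ck_flat_affine k P a b c : Ck k (flat P \o affine a b c).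
Proof.
have cP Q : continuous (flat Q \o affine a b c).
  move=> x; apply: continuous_comp; first exact: affine_continuous.
  exact: flat_continuous.
elim: k P => [|k ih] P; split => // i.
pose m := a * (unitv R i).1 + b * (unitv R i).2.
have dP x := is_derive_affine (unitv R i) (is_derive_flat P (affine a b c x)).
split=> [x|]; first by case: (dP x).
rewrite (_ : partial i _ = flat (m%:P * flat_deriv P) \o affine a b c).
  exact: ih.
apply/funext => x; rewrite /partial; case: (dP x) => _ -> /=; rewrite /flat.
by case: ifP => _; rewrite ?mulr0// [in RHS]hornerM hornerC mulrA.
Qed.

Variables a b c d : R.

(** As n grows, exp(-1/(n t)) tends to the indicator of t > 0; hence these smooth
    products tend to the indicator of the open box, while supported in its closure. *)
Definition bump (n : nat) : plane -> R :=
  (flat 1 \o affine n.+1%:R 0 (- (n.+1%:R * a))) *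
  (flat 1 \o affine (- n.+1%:R) 0 (n.+1%:R * b)) *
  (flat 1 \o affine 0 n.+1%:R (- (n.+1%:R * c))) *
  (flat 1 \o affine 0 (- n.+1%:R) (n.+1%:R * d)).

Lemma bumpE n (x : plane) : bump n x =
  flat 1 (n.+1%:R * (x.1 - a)) * flat 1 (n.+1%:R * (b - x.1)) *
  flat 1 (n.+1%:R * (x.2 - c)) * flat 1 (n.+1%:R * (d - x.2)).
Proof.
rewrite /bump !fctE /affine.
by congr (flat _ _ * flat _ _ * flat _ _ * flat _ _); ring.
Qed.

Lemma Ck_bump k n : Ck k (bump n).
Proof. by do !apply: CkM; exact: Ck_flat_affine. Qed.

Lemma flat1E t : flat 1 t = if 0 < t then expR (- t^-1) else 0.
Proof. by rewrite /flat -polyC1 hornerC mul1r. Qed.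

Lemma flat1_ge0 t : 0 <= flat 1 t.
Proof. by rewrite flat1E; case: ifP => // _; exact: expR_ge0. Qed.

Lemma flat1_le1 t : flat 1 t <= 1.
Proof.
rewrite flat1E; case: ifPn => // t0; rewrite -expR0 ler_expR.
by rewrite lerNl oppr0 invr_ge0 ltW.
Qed.

Lemma bump_ge0 n x : 0 <= bump n x.
Proof. by rewrite bumpE !mulr_ge0 ?flat1_ge0. Qed.

Lemma bump_le1 n x : bump n x <= 1.
Proof. by rewrite bumpE !mulr_ile1 ?mulr_ge0 ?flat1_ge0 ?flat1_le1. Qed.

Lemma bump_out n x : ~ obox a b c d x -> bump n x = 0.
Proof.
move=> nx; rewrite bumpE; apply/eqP; apply/negPn/negP; rewrite !mulf_eq0 !negb_or.
have pos t : flat 1 (n.+1%:R * t) != 0 -> 0 < t.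
  by rewrite flat1E pmulr_rgt0 ?ltr0n//; case: ifPn; rewrite ?eqxx.
move=> /andP[/andP[/andP[/pos + /pos +] /pos +] /pos +].
rewrite !subr_gt0 => xa xb xc xd; apply: nx.
by split; rewrite /= in_itv/= ?xa ?xb ?xc ?xd.
Qed.

Lemma flat1_cvg t : 0 < t -> flat 1 (n.+1%:R * t) @[n --> \oo] --> (1 : R).
Proof.
move=> t0; rewrite (_ : (fun n => _) = expR \o (fun n : nat => - (n.+1%:R^-1 * t^-1))).
  rewrite -[X in _ --> X]expR0; apply: continuous_cvg; first exact: continuous_expR.
  rewrite -oppr0 -[X in _ --> - X](mul0r t^-1); apply: cvgN.
  by apply: cvgM; [exact: cvg_harmonic|exact: cvg_cst].
apply/funext => n /=; rewrite flat1E pmulr_rgt0 ?ltr0n// t0.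
by rewrite invfM.
Qed.

Lemma bump_cvg x : obox a b c d x -> bump n x @[n --> \oo] --> (1 : R).
Proof.
move=> [/= + +]; rewrite !in_itv/= => /andP[xa xb] /andP[xc xd].
have -> : bump ^~ x = (fun n => flat 1 (n.+1%:R * (x.1 - a)))
    * (fun n => flat 1 (n.+1%:R * (b - x.1)))
    * (fun n => flat 1 (n.+1%:R * (x.2 - c)))
    * (fun n => flat 1 (n.+1%:R * (d - x.2))).
  by apply/funext => n; rewrite bumpE.
have one4 : 1 * 1 * 1 * 1 = 1 :> R by rewrite !mulr1.
rewrite -[X in _ --> X]one4.
by apply: cvgM; [apply: cvgM; [apply: cvgM|]|]; apply: flat1_cvg;
  rewrite subr_gt0.
Qed.

Lemma test_bump Omega n : cbox a b c d `<=` Omega -> test_function Omega (bump n).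
Proof.
move=> abO; have sb : support (bump n) `<=` cbox a b c d.
  rewrite (closure_id (cbox a b c d)).1; last first.
    by apply: compact_closed; [exact: norm_hausdorff|exact: compact_cbox].
  apply: closure_subset => x /= /eqP x0; apply: obox_cbox; apply: contrapT => nx.
  exact/x0/bump_out.
split; first by move=> k; exact: Ck_bump.
- by apply: (subclosed_compact _ _ sb); [exact: closed_closure|exact: compact_cbox].
- exact: subset_trans sb abO.
Qed.

End bump.

(** * The fundamental lemma of the calculus of variations *)

Section fundamental_lemma.
Context {R : realType}.
Local Notation plane := (R * R)%type.
Local Notation mplane := (measurableTypeR R * measurableTypeR R)%type.
Local Notation leb2 := (@leb2 R).

(** The sets A such that the integral over the part of Q above A vanishes form a
    Dynkin system. *)
Lemma integral_preimage_eq0 d (T : measurableType d) (pi : mplane -> T)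
    (G : set (set T)) (Q : set mplane) (g : plane -> R) :
  measurable_fun setT pi -> @measurable _ T = <<s G >> -> setI_closed G ->
  measurable Q -> leb2.-integrable Q (EFin \o g) ->
  (\int[leb2]_(x in Q) (g x)%:E = 0)%E ->
  (forall A, G A -> \int[leb2]_(x in Q `&` pi @^-1` A) (g x)%:E = 0)%E ->
  forall A, measurable A -> (\int[leb2]_(x in Q `&` pi @^-1` A) (g x)%:E = 0)%E.
Proof.
move=> mpi GE GI mQ ig Q0 G0 A; rewrite GE; move: A.
have mpre A : measurable A -> measurable (Q `&` pi @^-1` A).
  by move=> mA; apply: measurableI => //; rewrite -[_ @^-1` _]setTI; exact: mpi.
have mg := measurable_int _ ig.
have mg' : measurable_fun Q g by exact/measurable_EFinP.
apply: (dynkin_induction (P := fun A =>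
    (\int[leb2]_(x in Q `&` pi @^-1` A) (g x)%:E = 0)%E)) => //.
- by rewrite preimage_setT setIT.
- move=> S mS S0; rewrite -[LHS]add0e -[X in (X + _)%E]S0.
  rewrite -integral_setU_EFin//.
  + by rewrite -setIUr preimage_setC setUv setIT.
  + exact: mpre.
  + by apply: mpre; exact: measurableC.
  + by rewrite -setIUr; apply: measurable_funS mg' => //; exact: subIsetl.
  + rewrite disj_set2E; apply/eqP; rewrite setIACA setIid preimage_setC setICr.
    by rewrite setI0.
- move=> F mF tF F0; rewrite preimage_bigcup setI_bigcupr integral_bigcup//.
  + by rewrite eseries0.
  + apply/trivIsetP => i j _ _ ij; rewrite setIACA setIid -preimage_setI.
    move/trivIsetP : tF => /(_ i j Logic.I Logic.I ij) ->.
    by rewrite preimage_set0 setI0.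
  + by move=> k; exact: mpre.
  + rewrite -setI_bigcupr -preimage_bigcup.
    apply: (integrableS mQ _ (@subIsetl _ _ _) ig); apply: mpre.
    exact: bigcupT_measurable.
Qed.

Let itvoo_setI (a b c d : R) :
  `]a, b[%classic `&` `]c, d[%classic = `]Num.max a c, Num.min b d[%classic.
Proof.
apply/seteqP; split=> x /=; rewrite !in_itv/= gt_max lt_min.
  by move=> [/andP[-> ->] /andP[-> ->]].
by move=> /andP[/andP[-> ->] /andP[-> ->]].
Qed.

Let opens_setI : setI_closed (@RGenOpens.G R).
Proof.
move=> _ _ [a [b ->]] [c [d ->]]; exists (Num.max a c), (Num.min b d).
exact: itvoo_setI.
Qed.

(** Three passages from generators to measurable sets: for the first side of a
    rectangle, for the second one, and for the product structure. *)
Lemma integral_boxes_eq0 (a b c d : R) (g : plane -> R) :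
  leb2.-integrable (obox a b c d : set mplane) (EFin \o g) ->
  (forall a' b' c' d', a <= a' -> b' <= b -> c <= c' -> d' <= d ->
    (\int[leb2]_(x in obox a' b' c' d') (g x)%:E = 0)%E) ->
  forall E : set mplane, measurable E ->
    (\int[leb2]_(x in obox a b c d `&` E) (g x)%:E = 0)%E.
Proof.
set Q := obox a b c d => ig box0.
have mQ : measurable (Q : set mplane) by exact: measurable_obox.
have Q0 : (\int[leb2]_(x in Q) (g x)%:E = 0)%E by exact: box0.
have box1 (B1 B2 : set R) : RGenOpens.G B1 -> RGenOpens.G B2 ->
    (\int[leb2]_(x in Q `&` (snd @^-1` B2) `&` (fst @^-1` B1)) (g x)%:E = 0)%E.
  move=> [a1 [b1 ->]] [c1 [d1 ->]].
  rewrite (_ : _ `&` _ = obox (Num.max a a1) (Num.min b b1)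
      (Num.max c c1) (Num.min d d1)); last first.
    rewrite /obox -!itvoo_setI; apply/seteqP; split.
      by move=> x [[[h1 h2] h3] h4].
    by move=> x [[h1 h2] [h3 h4]].
  by apply: box0; rewrite ?le_max ?ge_min lexx.
have mA2 (B2 : set R) : measurable (B2 : set (measurableTypeR R)) ->
    measurable (Q `&` (snd @^-1` B2) : set mplane).
  move=> mB; apply: measurableI => //; rewrite -[_ @^-1` _]setTI.
  exact: (@measurable_snd _ _ (measurableTypeR R) (measurableTypeR R)).
have mA1 (B1 : set R) : measurable (B1 : set (measurableTypeR R)) ->
    measurable (Q `&` (fst @^-1` B1) : set mplane).
  move=> mB; apply: measurableI => //; rewrite -[_ @^-1` _]setTI.
  exact: (@measurable_fst _ _ (measurableTypeR R) (measurableTypeR R)).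
have igS (S : set mplane) : measurable S -> S `<=` Q ->
    leb2.-integrable S (EFin \o g).
  by move=> mS SQ; exact: integrableS ig.
have opensE := RGenOpens.measurableE R.
have mopen (B : set R) : RGenOpens.G B -> measurable (B : set (measurableTypeR R)).
  by move=> [x [y ->]]; exact: measurable_itv.
have strip (B2 : set R) : RGenOpens.G B2 ->
    (\int[leb2]_(x in Q `&` (snd @^-1` B2)) (g x)%:E = 0)%E.
  move=> B2o; apply: (@integral_preimage_eq0 _ (measurableTypeR R)
    snd (@RGenOpens.G R)) => //.
  move=> _ [c1 [d1 ->]].
  rewrite (_ : _ `&` _ = obox a b (Num.max c c1) (Num.min d d1)); last first.
    rewrite /obox -itvoo_setI.
    by apply/seteqP; split=> [x [[h1 h2] h3]|x [h1 [h2 h3]]].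
  by apply: box0; rewrite ?le_max ?ge_min lexx.
  exact: mopen.
have step1 (B1 B2 : set R) : measurable (B1 : set (measurableTypeR R)) ->
    RGenOpens.G B2 ->
    (\int[leb2]_(x in Q `&` (snd @^-1` B2) `&` (fst @^-1` B1)) (g x)%:E = 0)%E.
  move=> mB1 B2o; have mB2 := mopen _ B2o.
  apply: (@integral_preimage_eq0 _ (measurableTypeR R) fst (@RGenOpens.G R)) => //.
  - exact: mA2.
  - by apply: igS; [exact: mA2|exact: subIsetl].
  - exact: strip.
  - by move=> A Ao; exact: box1.
have step2 (B1 B2 : set R) : measurable (B1 : set (measurableTypeR R)) ->
    measurable (B2 : set (measurableTypeR R)) ->
    (\int[leb2]_(x in Q `&` (fst @^-1` B1) `&` (snd @^-1` B2)) (g x)%:E = 0)%E.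
  move=> mB1 mB2.
  apply: (@integral_preimage_eq0 _ (measurableTypeR R) snd (@RGenOpens.G R)) => //.
  - exact: mA1.
  - by apply: igS; [exact: mA1|exact: subIsetl].
  - apply: (@integral_preimage_eq0 _ (measurableTypeR R) fst (@RGenOpens.G R)) => //.
    move=> _ [c1 [d1 ->]].
    rewrite (_ : _ `&` _ = obox (Num.max a c1) (Num.min b d1) c d); last first.
      rewrite /obox -itvoo_setI.
      by apply/seteqP; split=> [x [[h1 h2] h3]|x [[h1 h3] h2]].
    by apply: box0; rewrite ?le_max ?ge_min lexx.
  - by move=> A Ao; rewrite setIAC; exact: step1.
move=> E mE; rewrite -[E]preimage_id.
apply: (integral_preimage_eq0
  (G := [set A `*` B | A in measurable & B in measurable])) => //.
- exact: measurable_prod_measurableType.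
- move=> _ _ [A1 mA1' [B1 mB1 <-]] [A2 mA2' [B2 mB2 <-]]; rewrite -setXI.
  exists (A1 `&` A2); first exact: measurableI.
  by exists (B1 `&` B2) => //; exact: measurableI.
- move=> _ [A1 mA1' [B1 mB1 <-]].
  rewrite preimage_id (_ : _ `&` _ = Q `&` (fst @^-1` A1) `&` (snd @^-1` B1)).
    exact: step2.
  by rewrite -setIA; congr (_ `&` _); apply/seteqP; split.
Qed.

Variable Omega : set plane.
Hypothesis oOmega : open Omega.
Hypothesis bOmega : bounded_set Omega.
Let mOmega : measurable (Omega : set mplane) := open_measurable_plane oOmega.

Lemma L2_integrable (g : plane -> R) : L2 Omega g ->
  leb2.-integrable Omega (EFin \o g).
Proof.
move=> Lg; have L1 : L2 Omega (fun=> 1).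
  by apply: L2_continuous => // x; exact: cvg_cst.
have := L2M mOmega Lg L1; rewrite /intg.
by rewrite (_ : (fun x => _) = g)//; apply/funext => x; rewrite mulr1.
Qed.

(** Dominated convergence along the bumps, which are test functions of Omega as the
    closed box lies in Omega. *)
Lemma integral_box_eq0 (g : plane -> R) a b c d : L2 Omega g ->
  (forall phi, test_function Omega phi -> dot0 Omega g phi = 0) ->
  cbox a b c d `<=` Omega ->
  (\int[leb2]_(x in obox a b c d) (g x)%:E = 0)%E.
Proof.
move=> Lg g0 abO; have ig := L2_integrable Lg.
have mg := measurable_int _ ig.
have obO : obox a b c d `<=` Omega by apply: subset_trans abO; exact: obox_cbox.
have Lbump n : L2 Omega (bump a b c d n).
  by apply: L2_continuous => //; exact: (Ck_continuous (Ck_bump a b c d 0 n)).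
have igb n := L2M mOmega Lg (Lbump n).
rewrite -[X in integral _ X _](setIidr obO) integral_mkcondr.
pose f_ n : plane -> \bar R := EFin \o (fun x => g x * bump a b c d n x).
have [|||||_ _] := @dominated_convergence _ mplane R leb2 Omega mOmega
  f_ ((EFin \o g) \_ (obox a b c d)) (EFin \o (fun x => `|g x|)).
- by move=> n; exact: measurable_int (igb n).
- apply/(measurable_restrict _ (measurable_obox _ _ _ _) mOmega).
  by apply: measurable_funS mg => //; exact: subIsetl.
- apply: aeW => x Ox; rewrite patchE /f_.
  case: ifPn => [/set_mem xb|/negP xb].
    apply: cvg_EFin; first exact: nearW.
    rewrite -[X in _ --> X]mulr1; apply: cvgM; first exact: cvg_cst.
    exact: bump_cvg.
  rewrite (_ : (fun n => _) = cst 0%E); first exact: cvg_cst.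
  apply/funext => n /=; rewrite bump_out ?mulr0// => xb'; apply: xb.
  exact: mem_set.
- exact: integrable_norm ig.
- apply: aeW => x n Ox; rewrite /f_/= lee_fin normrM ler_piMr//.
  by rewrite ger0_norm ?bump_ge0// bump_le1.
rewrite (_ : (fun n => _) = cst 0%E).
  by move=> /cvg_lim <- //; rewrite lim_cst.
apply/funext => n /=.
rewrite -(fineK (integrable_fin_num mOmega (igb n))); congr EFin.
exact: g0 _ (test_bump n abO).
Qed.

(** The integrals of g over the boxes inside Omega determine g almost everywhere on
    each such box, and countably many of them cover Omega. *)
Lemma L2_test_eq0 (g : plane -> R) : L2 Omega g ->
  (forall phi, test_function Omega phi -> dot0 Omega g phi = 0) ->
  aeq Omega g (fun=> 0).
Proof.
move=> Lg g0; have ig := L2_integrable Lg; have mg := measurable_int _ ig.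
pose N n : set mplane := let: (a, b, c, d) := ratbox n in
  if `[< cbox a b c d `<=` Omega >] then obox a b c d `&` [set x | g x != 0]
  else set0.
have negN n : leb2.-negligible (N n).
  rewrite /N; case: (ratbox n) => [[[a b] c] d].
  case: asboolP => [abO|_]; last exact: negligible_set0.
  have obO : obox a b c d `<=` Omega by apply: subset_trans abO; exact: obox_cbox.
  have igb : leb2.-integrable (obox a b c d : set mplane) (EFin \o g).
    by apply: integrableS ig => //; exact: measurable_obox.
  have : ae_eq leb2 (obox a b c d) (EFin \o g) (cst 0%E).
    apply: integral_ae_eq => //; first exact: measurable_obox.
    move=> E EQ mE; rewrite integral0 -(setIidr EQ).
    apply: (integral_boxes_eq0 igb) => // a' b' c' d' ha hb hc hd.
    apply: integral_box_eq0 => //; apply: subset_trans abO => x [/= + +].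
    rewrite !in_itv/= => /andP[xa xb] /andP[xc xd].
    by split; rewrite /= in_itv/=; apply/andP; split; lra.
  apply: negligibleS => x [xb /eqP gx] /= h; apply: gx.
  by have [] := h xb.
have := negligible_bigcup negN; apply: negligibleS => x /= h.
have [Ox gx] : Omega x /\ g x <> 0 by apply/not_implyP.
have [n] := open_ratbox oOmega Ox; case E : (ratbox n) => [[[a b] c] d] [abU ox].
exists n => //; rewrite /N E asboolT//; split => //; exact/eqP.
Qed.

End fundamental_lemma.

(** * Sobolev functions *)

Section sobolev.
Context {R : realType}.
Local Notation plane := (R * R)%type.
Local Notation mplane := (measurableTypeR R * measurableTypeR R)%type.
Local Notation leb2 := (@leb2 R).
Variable Omega : set plane.
Hypothesis oOmega : open Omega.
Hypothesis bOmega : bounded_set Omega.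
Let mOmega : measurable (Omega : set mplane) := open_measurable_plane oOmega.

Lemma L2DZ (u v : plane -> R) a : L2 Omega u -> L2 Omega v ->
  L2 Omega (u + a *: v).
Proof. by move=> Lu Lv; apply: L2D => //; exact: L2Z. Qed.

Lemma test_L2 phi : test_function Omega phi -> L2 Omega phi.
Proof.
by move=> [Cphi _ _]; apply: L2_continuous => //; exact: (Ck_continuous (Cphi 0)).
Qed.

Lemma test_partial_L2 i phi : test_function Omega phi -> L2 Omega (partial i phi).
Proof.
move=> [Cphi _ _]; apply: L2_continuous => //.
by have [_ /(_ i)[_ [? _]]] := Cphi 1%N.
Qed.

Lemma weak_partial_unique i (u g1 g2 : plane -> R) :
  is_weak_partial Omega i u g1 -> is_weak_partial Omega i u g2 ->
  aeq Omega g1 g2.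
Proof.
move=> [L1 w1] [L2' w2].
have : aeq Omega (g1 - g2) (fun=> 0).
  apply: L2_test_eq0 => //; first exact: L2B.
  move=> phi tphi; rewrite dot0Bl//; last exact: test_L2.
  by apply/eqP; rewrite subr_eq0 -eqr_opp -w1// -w2.
by apply: filterS => x h Ox; apply/eqP; rewrite -subr_eq0; apply/eqP; exact: h.
Qed.

(** Linearity is stated for u + a v throughout, which covers sums and differences
    in one go. *)
Lemma weak_partialDZ i (u v g h : plane -> R) a :
  L2 Omega u -> L2 Omega v ->
  is_weak_partial Omega i u g -> is_weak_partial Omega i v h ->
  is_weak_partial Omega i (u + a *: v) (g + a *: h).
Proof.
move=> Lu Lv [Lg wg] [Lh wh]; split; first exact: L2DZ.
move=> phi tphi; have Lp := test_L2 tphi; have Ldp := test_partial_L2 i tphi.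
rewrite dot0Dl//; last exact: L2Z.
rewrite dot0Dl//; last exact: L2Z.
by rewrite !dot0Zl// wg// wh// mulrN opprD.
Qed.

Lemma H1_L2 u : H1 Omega u -> L2 Omega u.
Proof. by case. Qed.

Lemma wpartialP i u : H1 Omega u -> is_weak_partial Omega i u (wpartial Omega i u).
Proof. by move=> [_ /(_ i) ex]; exact: (xgetPex _ ex). Qed.

Lemma wpartial_L2 i u : H1 Omega u -> L2 Omega (wpartial Omega i u).
Proof. by move=> /(wpartialP i)[]. Qed.

Lemma wpartial_eq i u g : H1 Omega u -> is_weak_partial Omega i u g ->
  aeq Omega (wpartial Omega i u) g.
Proof. by move=> /(wpartialP i); exact: weak_partial_unique. Qed.

Lemma H1DZ u v a : H1 Omega u -> H1 Omega v -> H1 Omega (u + a *: v).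
Proof.
move=> [Lu Wu] [Lv Wv]; split; first exact: L2DZ.
move=> i; have [g wg] := Wu i; have [h wh] := Wv i.
by exists (g + a *: h); exact: weak_partialDZ.
Qed.

(** Weak derivatives are unique almost everywhere only, so that no pointwise identity
    holds between the chosen representatives. *)
Lemma wpartialDZ i u v a : H1 Omega u -> H1 Omega v ->
  aeq Omega (wpartial Omega i (u + a *: v))
            (wpartial Omega i u + a *: wpartial Omega i v).
Proof.
move=> Hu Hv; apply: wpartial_eq; first exact: H1DZ.
by apply: weak_partialDZ; [exact: H1_L2|exact: H1_L2|exact: wpartialP..].
Qed.

Lemma grad_L2mx u : H1 Omega u -> L2mx Omega (grad Omega u).
Proof.
move=> Hu i j; rewrite (_ : (fun x => _) = wpartial Omega i u).
  exact: wpartial_L2.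
by apply/funext => x; rewrite mxE.
Qed.

Lemma gradDZ u v a : H1 Omega u -> H1 Omega v ->
  aeq Omega (grad Omega (u + a *: v)) (grad Omega u + a *: grad Omega v).
Proof.
move=> Hu Hv; have := wpartialDZ 0 a Hu Hv; have := wpartialDZ 1 a Hu Hv.
apply: filterS2 => x e1 e0 Ox; apply/colP => i; rewrite !fctE !mxE.
have [->|->] := ord2P i.
- by rewrite e0.
- by rewrite e1.
Qed.

Lemma seminorm1_ge0 u : 0 <= seminorm1 Omega u.
Proof. exact: normmx_ge0. Qed.

Lemma seminorm1DZ u v a : H1 Omega u -> H1 Omega v ->
  seminorm1 Omega (u + a *: v) <= seminorm1 Omega u + `|a| * seminorm1 Omega v.
Proof.
move=> Hu Hv; have Gu := grad_L2mx Hu; have Gv := grad_L2mx Hv.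
have Gav := L2mxZ mOmega a Gv.
rewrite /seminorm1 (normmx_aeq mOmega _ _ (gradDZ a Hu Hv)).
- by rewrite -normmxZ//; exact: normmxD.
- exact/grad_L2mx/H1DZ.
- exact: L2mxD.
Qed.

Lemma norm0_wpartial_le i u : H1 Omega u ->
  norm0 Omega (wpartial Omega i u) <= seminorm1 Omega u.
Proof.
move=> Hu; rewrite (_ : wpartial Omega i u = fun x => grad Omega u x i 0).
  exact/norm0_entry_le/grad_L2mx.
by apply/funext => x; rewrite mxE.
Qed.

Lemma norm0_le_norm1 u : norm0 Omega u <= norm1 Omega u.
Proof.
by rewrite -[leLHS]ger0_norm ?norm0_ge0// -sqrtr_sqr ler_wsqrtr// lerDl sqr_ge0.
Qed.

Lemma seminorm1_le_norm1 u : seminorm1 Omega u <= norm1 Omega u.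
Proof.
by rewrite -[leLHS]ger0_norm ?seminorm1_ge0// -sqrtr_sqr ler_wsqrtr// lerDr sqr_ge0.
Qed.

Lemma norm1_le u : norm1 Omega u <= norm0 Omega u + seminorm1 Omega u.
Proof.
have a0 := norm0_ge0 Omega u; have b0 := seminorm1_ge0 u.
rewrite -[leRHS]ger0_norm ?addr_ge0// -sqrtr_sqr ler_wsqrtr//.
by rewrite sqrrD lerD2r lerDl mulrn_wge0// mulr_ge0.
Qed.

Lemma test_H1 phi : test_function Omega phi -> H1 Omega phi.
Proof. by move=> [Cphi _ _]; apply: Ck1_H1 => //; exact: (Cphi 1%N). Qed.

Lemma wpartial_test i phi : test_function Omega phi ->
  aeq Omega (wpartial Omega i phi) (partial i phi).
Proof.
move=> tphi; apply: wpartial_eq; first exact: test_H1.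
by case: tphi => Cphi _ _; apply: Ck1_weak_partial => //; exact: (Cphi 1%N).
Qed.

Lemma Ck_cst k (a : R) : Ck k (fun _ : plane => a).
Proof.
elim: k a => [|k ih] a; first by split => // x; exact: cvg_cst.
split=> [x|i]; first exact: cvg_cst.
split=> [x|]; first exact: derivable_cst.
rewrite (_ : partial i _ = fun=> 0); first exact: ih.
by apply/funext => x; exact: derive_cst.
Qed.

Lemma test_functionDZ phi psi a : test_function Omega phi ->
  test_function Omega psi -> test_function Omega (phi + a *: psi).
Proof.
move=> [Cphi kphi sphi] [Cpsi kpsi spsi].
have sub : support (phi + a *: psi) `<=` support phi `|` support psi.
  rewrite /support -closureU; apply: closure_subset => x /= h.
  have [p0|] := eqVneq (phi x) 0; last by left.
  right; apply: contra h => /eqP q0; rewrite !fctE p0 q0.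
  by rewrite /GRing.scale/= mulr0 addr0.
split.
- by move=> k; apply: CkD => //; apply: CkM => //; exact: Ck_cst.
- apply: (subclosed_compact _ _ sub); first exact: closed_closure.
  exact: compactU.
- by apply: subset_trans sub _; rewrite subUset.
Qed.

Lemma H10_H1 u : H10 Omega u -> H1 Omega u.
Proof. by case. Qed.

Lemma H10_approx u (e : R) : H10 Omega u -> 0 < e -> exists phi,
  [/\ test_function Omega phi, norm0 Omega (u - phi) <= e &
      seminorm1 Omega (u - phi) <= e].
Proof.
move=> [_ Hu] e0; have [phi [tphi ue]] := Hu _ e0; exists phi; split => //.
- by apply: le_trans (ltW ue); exact: norm0_le_norm1.
- by apply: le_trans (ltW ue); exact: seminorm1_le_norm1.
Qed.

Lemma H1B u v : H1 Omega u -> H1 Omega v -> H1 Omega (u - v).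
Proof. by move=> Hu Hv; rewrite -scaleN1r; exact: H1DZ. Qed.

Lemma norm0DZ u v a : L2 Omega u -> L2 Omega v ->
  norm0 Omega (u + a *: v) <= norm0 Omega u + `|a| * norm0 Omega v.
Proof.
move=> Lu Lv; apply: le_trans (norm0D mOmega Lu (L2Z mOmega a Lv)) _.
by rewrite !norm0E mx1Z (normmxZ mOmega)//; exact: L2_mx1.
Qed.

Lemma H10DZ u v a : H10 Omega u -> H10 Omega v -> H10 Omega (u + a *: v).
Proof.
move=> Hu Hv; split; first by apply: H1DZ; exact: H10_H1.
move=> e e0; pose d := e / (2 * (2 + `|a|)).
have a2 : 0 < 2 + `|a| by rewrite ltr_wpDr.
have d0 : 0 < d by rewrite divr_gt0// mulr_gt0.
have [phi [tphi p0 p1]] := H10_approx Hu d0.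
have [psi [tpsi q0 q1]] := H10_approx Hv d0.
exists (phi + a *: psi); split; first exact: test_functionDZ.
rewrite (_ : _ - _ = (u - phi) + a *: (v - psi)); last first.
  by rewrite scalerBr opprD addrACA.
have Hp := H1B (H10_H1 Hu) (test_H1 tphi).
have Hq := H1B (H10_H1 Hv) (test_H1 tpsi).
apply: le_lt_trans (norm1_le _) _.
apply: (@le_lt_trans _ _ (2 * ((1 + `|a|) * d))).
  rewrite mulr_natl mulr2n; apply: lerD.
    apply: le_trans (norm0DZ a (H1_L2 Hp) (H1_L2 Hq)) _.
    by rewrite mulrDl mul1r; exact: lerD p0 (ler_wpM2l (normr_ge0 a) q0).
  apply: le_trans (seminorm1DZ a Hp Hq) _.
  by rewrite mulrDl mul1r; exact: lerD p1 (ler_wpM2l (normr_ge0 a) q1).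
rewrite (_ : e = 2 * ((2 + `|a|) * d)); last by rewrite /d; field; rewrite gt_eqF.
by rewrite ltr_pM2l// ltr_pM2r// ltrD2r ltr1n.
Qed.

Lemma partial_affine i a b c (x : plane) :
  partial i (affine a b c) x = a * (unitv R i).1 + b * (unitv R i).2.
Proof.
have := is_derive_affine (unitv R i) (is_derive_id (affine a b c x) (1 : R)).
by rewrite mulr1 => -[].
Qed.

Lemma Ck1_affine a b c : Ck 1 (affine a b c : plane -> R).
Proof.
split; first exact: affine_continuous.
move=> i; split=> [x|].
  by have := is_derive_affine (unitv R i) (is_derive_id (affine a b c x) (1 : R)) => -[].
split=> //; rewrite (_ : partial i _ = fun=> a * (unitv R i).1 + b * (unitv R i).2).
  by move=> x; exact: cvg_cst.
by apply/funext => x; exact: partial_affine.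
Qed.

(** Integrating the derivative of x_0 phi^2 gives
    |phi|^2 = - 2 (x_0 d_0 phi, phi), and x_0 is bounded on Omega. *)
Lemma test_poincare (M : R) phi : 0 < M -> (forall x, Omega x -> `|x.1| <= M) ->
  test_function Omega phi -> norm0 Omega phi <= 2 * M * seminorm1 Omega phi.
Proof.
move=> M0 OM tphi; have Hp := test_H1 tphi; have Lp := test_L2 tphi.
have Ld := test_partial_L2 0 tphi.
have [Cphi _ _] := tphi; have C1 := Cphi 1%N.
have cx : continuous (affine 1 0 0 : plane -> R) by exact: affine_continuous.
have affE (x : plane) : affine 1 0 0 x = x.1 by rewrite /affine; ring.
have Lxd : L2 Omega (affine 1 0 0 * partial 0 phi).
  apply: L2_continuous => // x; apply: continuousM; first exact: cx.
  by have [_ /(_ 0)[_ [cd _]]] := C1; exact: cd.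
have xd : norm0 Omega (affine 1 0 0 * partial 0 phi) <=
    M * norm0 Omega (partial 0 phi).
  rewrite -[leRHS]ger0_norm; last by rewrite mulr_ge0 ?norm0_ge0// ltW.
  rewrite -sqrtr_sqr {1}/norm0 ler_wsqrtr// exprMn norm0_sqr /dot0.
  rewrite -RintegralZl//; last exact: L2M.
  apply: le_Rintegral => //; first exact: L2M.
    by apply: intgZ => //; exact: L2M.
  move=> x Ox; rewrite !fctE affE mulrACA -!expr2 ler_wpM2r ?sqr_ge0//.
  rewrite -(real_normK (num_real x.1)) ler_pXn2r ?nnegrE ?normr_ge0//.
    exact: OM.
  exact: ltW.
have ibp := integral_by_parts mOmega bOmega 0 (CkM (Ck1_affine 1 0 0) C1) tphi.
have partE : partial 0 (affine 1 0 0 * phi) = affine 1 0 0 * partial 0 phi + phi.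
  apply/funext => x; rewrite partialM.
  - by rewrite partial_affine !fctE /unitv/= !mulr1 mul0r addr0 mul1r.
  - by have [_ /(_ 0)[]] := Ck1_affine 1 0 0.
  - by have [_ /(_ 0)[]] := C1.
rewrite partE dot0Dl// in ibp.
have swap : dot0 Omega (affine 1 0 0 * phi) (partial 0 phi) =
    dot0 Omega (affine 1 0 0 * partial 0 phi) phi.
  by apply: eq_Rintegral => x _; rewrite !fctE; ring.
rewrite swap in ibp.
have sq : norm0 Omega phi ^+ 2 <=
    2 * M * norm0 Omega (partial 0 phi) * norm0 Omega phi.
  rewrite norm0_sqr (_ : dot0 _ phi phi =
    - 2 * dot0 Omega (affine 1 0 0 * partial 0 phi) phi); last by lra.
  apply: le_trans (ler_norm _) _; rewrite normrM normrN normr_nat -!mulrA.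
  rewrite ler_pM2l//; apply: le_trans (cauchy_schwarz0 mOmega Lxd Lp) _.
  by rewrite mulrA ler_wpM2r// norm0_ge0.
have : norm0 Omega phi <= 2 * M * norm0 Omega (partial 0 phi).
  have := norm0_ge0 Omega phi; rewrite le_eqVlt => /predU1P[<-|p0].
    by rewrite !mulr_ge0 ?norm0_ge0// ltW.
  by move: sq; rewrite expr2 ler_pM2r.
move=> /le_trans; apply; apply: ler_wpM2l; first by rewrite mulr_ge0// ltW.
rewrite (_ : norm0 _ _ = norm0 Omega (wpartial Omega 0 phi)).
  exact: norm0_wpartial_le.
rewrite !norm0E; apply: normmx_aeq => //; [exact: L2_mx1| |].
  exact/L2_mx1/wpartial_L2.
exact: (aeq_comp (fun r : R => const_mx r) (aeq_sym (wpartial_test 0 tphi))).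
Qed.

Lemma le_of_le_eps (a b K : R) : 0 <= K ->
  (forall e, 0 < e -> a <= b + K * e) -> a <= b.
Proof.
move=> K0 h; apply/ler_addgt0Pr => e e0.
have K1 : 0 < K + 1 by rewrite ltr_wpDl.
apply: le_trans (h (e / (K + 1)) _) _; first by rewrite divr_gt0.
by rewrite lerD2l mulrA ler_pdivrMr// mulrC ler_pM2l// lerDl.
Qed.

Lemma poincare : exists2 C : R, 0 < C &
  forall u, H10 Omega u -> norm0 Omega u <= C * seminorm1 Omega u.
Proof.
have [M M0 OM] := bounded_cbox bOmega.
exists (2 * M) => [|u Hu]; first by rewrite mulr_gt0.
have Hu1 := H10_H1 Hu.
apply: (@le_of_le_eps _ _ (1 + 2 * M)); first by rewrite addr_ge0 ?mulr_ge0 ?ltW.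
move=> e e0; have [phi [tphi p0 p1]] := H10_approx Hu e0.
have Hp := test_H1 tphi; have Hd := H1B Hu1 Hp.
have := norm0D mOmega (H1_L2 Hd) (H1_L2 Hp); rewrite subrK => /le_trans; apply.
have hp : norm0 Omega phi <= 2 * M * seminorm1 Omega phi.
  by apply: test_poincare => // x /OM[/=]; rewrite in_itv/= -ler_norml.
have hs : seminorm1 Omega phi <= seminorm1 Omega u + e.
  have -> : phi = u + (-1) *: (u - phi) by rewrite scaleN1r opprB addrC subrK.
  apply: le_trans (seminorm1DZ (-1) Hu1 Hd) _.
  by rewrite normrN1 mul1r lerD2l.
have M2 : 0 <= 2 * M by rewrite mulr_ge0// ltW.
have split_bound (S : R) : 2 * M * S + (1 + 2 * M) * e = e + 2 * M * (S + e) by ring.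
rewrite split_bound; apply: (lerD p0).
exact: le_trans hp (ler_wpM2l M2 hs).
Qed.

(** Both sides are continuous in chi for the H^1 norm, and agree on test
    functions by definition of the weak derivative. *)
Lemma H1_H10_by_parts i q chi : H1 Omega q -> H10 Omega chi ->
  dot0 Omega (wpartial Omega i q) chi = - dot0 Omega q (wpartial Omega i chi).
Proof.
move=> Hq Hc; have Hc1 := H10_H1 Hc.
have Lq := H1_L2 Hq; have Lc := H1_L2 Hc1.
have Lwq := wpartial_L2 i Hq; have Lwc := wpartial_L2 i Hc1.
apply/eqP; rewrite -subr_eq0 opprK -normr_le0.
apply: (@le_of_le_eps _ _ (norm0 Omega (wpartial Omega i q) + norm0 Omega q)).
  by rewrite addr_ge0 ?norm0_ge0.
move=> e e0; rewrite add0r; have [phi [tphi p0 p1]] := H10_approx Hc e0.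
have Lp := test_L2 tphi; have Hp := test_H1 tphi; have Lwp := wpartial_L2 i Hp.
have Hd := H1B Hc1 Hp; have Ld := H1_L2 Hd; have Lwd := wpartial_L2 i Hd.
have [_ /(_ _ tphi) wq] := wpartialP i Hq.
have wphi : dot0 Omega (partial i phi) q = dot0 Omega (wpartial Omega i phi) q.
  apply: (dot0_aeq mOmega (test_partial_L2 i tphi) Lwp Lq).
  exact/aeq_sym/wpartial_test.
have wd : dot0 Omega (wpartial Omega i (chi - phi)) q =
    dot0 Omega (wpartial Omega i chi) q - dot0 Omega (wpartial Omega i phi) q.
  rewrite -(dot0Bl mOmega Lwc Lwp Lq).
  apply: (dot0_aeq mOmega Lwd (L2B mOmega Lwc Lwp) Lq).
  by rewrite -(scaleN1r phi) -(scaleN1r (wpartial _ _ phi)); exact: wpartialDZ.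
have cd : dot0 Omega (chi - phi) (wpartial Omega i q) =
    dot0 Omega chi (wpartial Omega i q) - dot0 Omega phi (wpartial Omega i q).
  exact: dot0Bl.
have -> : dot0 Omega (wpartial Omega i q) chi + dot0 Omega q (wpartial Omega i chi)
    = dot0 Omega (chi - phi) (wpartial Omega i q)
      + dot0 Omega (wpartial Omega i (chi - phi)) q.
  rewrite wd cd -wphi (dot0C Omega (wpartial Omega i q) chi).
  rewrite (dot0C Omega q (wpartial Omega i chi)) (dot0C Omega (partial i phi) q) wq.
  by rewrite (dot0C Omega phi) opprK addrACA addNr addr0.
apply: le_trans (ler_normD _ _) _; rewrite mulrDl; apply: lerD.
  apply: le_trans (cauchy_schwarz0 mOmega Ld Lwq) _.
  by rewrite mulrC; apply: (ler_wpM2l (norm0_ge0 _ _)); exact: p0.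
apply: le_trans (cauchy_schwarz0 mOmega Lwd Lq) _.
have le_e := le_trans (norm0_wpartial_le i Hd) p1.
by rewrite mulrC; apply: (ler_wpM2l (norm0_ge0 _ _)); exact: le_e.
Qed.

End sobolev.

(** * The symmetric curl *)

Section symmetric_curl.
Context {R : realType}.
Local Notation plane := (R * R)%type.
Local Notation mplane := (measurableTypeR R * measurableTypeR R)%type.
Variable Omega : set plane.
Hypothesis oOmega : open Omega.
Hypothesis bOmega : bounded_set Omega.
Let mOmega : measurable (Omega : set mplane) := open_measurable_plane oOmega.
Implicit Types (u v w chi : plane -> R) (p q r : plane -> 'cV[R]_2).

Lemma pimx_L2mx u : L2 Omega u -> L2mx Omega (pimx u).
Proof.
move=> Lu i j; rewrite (_ : (fun x => _) = (i == j)%:R *: u); first exact: L2Z.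
by apply/funext => x; rewrite /pimx mxE; exact: esym (mulr_natl _ _).
Qed.

Lemma pimxB u v : pimx (u - v) = pimx u - pimx v.
Proof. by apply/funext => x; rewrite /pimx !fctE raddfB. Qed.

Lemma normmx_pimx_le u : L2 Omega u ->
  normmx Omega (pimx u) <= 2 * norm0 Omega u.
Proof.
move=> Lu; rewrite -(ler_pXn2r (ltn0Sn 1)) ?nnegrE ?mulr_ge0 ?norm0_ge0 ?normmx_ge0//.
rewrite exprMn normmx_sqr norm0_sqr.
rewrite (_ : dotmx _ _ _ = 2 * dot0 Omega u u).
  by rewrite ler_wpM2r -?norm0_sqr ?sqr_ge0// -natrX ler_nat.
rewrite /dot0 -RintegralZl//; last exact: L2M.
apply: eq_Rintegral => x _; rewrite !big_ord_recl !big_ord0 !mxE /=; ring.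
Qed.

Lemma vec_entryDZ p q a j : (fun x => (p + a *: q) x j 0) =
  (fun x => p x j 0) + a *: (fun x => q x j 0).
Proof. by apply/funext => x; rewrite !fctE !mxE. Qed.

Lemma H1vecDZ p q a : H1vec Omega p -> H1vec Omega q -> H1vec Omega (p + a *: q).
Proof. by move=> Hp Hq j; rewrite vec_entryDZ; exact: H1DZ. Qed.

Lemma H1vec_L2mx p : H1vec Omega p -> L2mx Omega p.
Proof. by move=> Hp i j; rewrite ord1; exact/H1_L2/Hp. Qed.

Lemma curlmxE p x i j : curlmx Omega p x i j =
  if j == 0 then wpartial Omega 1 (fun y => p y i 0) x
  else - wpartial Omega 0 (fun y => p y i 0) x.
Proof. by rewrite !mxE. Qed.

Lemma curlmx_L2mx p : H1vec Omega p -> L2mx Omega (curlmx Omega p).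
Proof.
move=> Hp i j; have [->|->] := ord2P j.
- rewrite (_ : (fun x => _) = wpartial Omega 1 (fun x => p x i 0)).
    exact/wpartial_L2/Hp.
  by apply/funext => x; rewrite !mxE.
- rewrite (_ : (fun x => _) = - wpartial Omega 0 (fun x => p x i 0)).
    exact/L2N/wpartial_L2/Hp.
  by apply/funext => x; rewrite !mxE.
Qed.

Lemma symcurl_L2mx p : H1vec Omega p -> L2mx Omega (symcurl Omega p).
Proof.
move=> /curlmx_L2mx Hp; apply: (L2mxZ mOmega 2^-1 (F := fun x => _ + _)).
apply: (L2mxD mOmega Hp) => i j.
rewrite (_ : (fun x => _) = fun x => curlmx Omega p x j i); first exact: Hp.
by apply/funext => x; rewrite mxE.
Qed.

Lemma symcurlDZ p q a : H1vec Omega p -> H1vec Omega q ->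
  aeq Omega (symcurl Omega (p + a *: q)) (symcurl Omega p + a *: symcurl Omega q).
Proof.
move=> Hp Hq.
have e i j := wpartialDZ oOmega bOmega i a (Hp j) (Hq j).
have : \forall x \ae leb2 R, Omega x ->
    curlmx Omega (p + a *: q) x = curlmx Omega p x + a *: curlmx Omega q x.
  apply: (filterS _ (filterI (filterI (e 0 0) (e 0 1)) (filterI (e 1 0) (e 1 1)))).
  move=> x [[e00 e01] [e10 e11]] Ox.
  have ex i j : wpartial Omega i ((fun y => p y j 0) + a *: (fun y => q y j 0)) x =
      wpartial Omega i (fun y => p y j 0) x + a * wpartial Omega i (fun y => q y j 0) x.
    have [->|->] := ord2P i; have [->|->] := ord2P j.
    - by rewrite (e00 Ox).
    - by rewrite (e01 Ox).
    - by rewrite (e10 Ox).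
    - by rewrite (e11 Ox).
  apply/matrixP => i j; rewrite [RHS]mxE !curlmxE vec_entryDZ [in RHS]mxE curlmxE.
  by case: ifP => _; rewrite ex// mulrN opprD.
apply: filterS => x /[apply] h.
rewrite /symcurl h !fctE /sym; apply/matrixP => i j; rewrite !mxE; ring.
Qed.

Lemma symcurlB p q : H1vec Omega p -> H1vec Omega q ->
  aeq Omega (symcurl Omega (p - q)) (symcurl Omega p - symcurl Omega q).
Proof.
move=> Hp Hq; rewrite -(scaleN1r q) -(scaleN1r (symcurl Omega q)).
exact: symcurlDZ.
Qed.

Lemma H1vecB p q : H1vec Omega p -> H1vec Omega q -> H1vec Omega (p - q).
Proof. by move=> Hp Hq; rewrite -scaleN1r; exact: H1vecDZ. Qed.

Lemma normmx_symcurlB p q : H1vec Omega p -> H1vec Omega q ->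
  normmx Omega (symcurl Omega (p - q)) =
  normmx Omega (symcurl Omega p - symcurl Omega q).
Proof.
move=> Hp Hq; apply: (normmx_aeq mOmega) (symcurlB Hp Hq).
- exact/symcurl_L2mx/H1vecB.
- by apply: L2mxB => //; exact: symcurl_L2mx.
Qed.

Lemma seminorm1B u v : H1 Omega u -> H1 Omega v ->
  seminorm1 Omega (u - v) = normmx Omega (grad Omega u - grad Omega v).
Proof.
move=> Hu Hv; apply: (normmx_aeq mOmega).
- exact/grad_L2mx/H1B.
- by apply: L2mxB => //; exact: grad_L2mx.
- by rewrite -(scaleN1r v) -(scaleN1r (grad Omega v)); exact: gradDZ.
Qed.

Lemma sigma_L2mx p w : H1vec Omega p -> L2 Omega w -> L2mx Omega (sigma Omega p w).
Proof.
by move=> Hp Lw; apply: L2mxD => //; [exact: symcurl_L2mx|exact: pimx_L2mx].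
Qed.

Lemma sym_dot_scalar (t : 'M[R]_2) (c : R) :
  \sum_i \sum_j sym t i j * (c%:M : 'M[R]_2) i j = (t 0 0 + t 1 1) * c.
Proof.
rewrite !big_ord_recl !big_ord0 !mxE /=.
rewrite (_ : lift ord0 ord0 = 1); last exact/val_inj.
by rewrite (_ : ord0 = 0); [field|exact/val_inj].
Qed.

(** The trace of sym curl d is a rotated divergence, so that a derivative can be
    moved onto chi. *)
Lemma symcurl_pimx_le d chi : H1vec Omega d -> H10 Omega chi ->
  dotmx Omega (symcurl Omega d) (pimx chi) <=
  2 * normmx Omega d * seminorm1 Omega chi.
Proof.
move=> Hd Hc; have Hc1 := H10_H1 Hc; have Lc := H1_L2 Hc1.
have L10 := wpartial_L2 1 (Hd 0); have L01 := wpartial_L2 0 (Hd 1).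
have -> : dotmx Omega (symcurl Omega d) (pimx chi) =
    dot0 Omega (wpartial Omega 1 (fun x => d x 0 0)) chi
    - dot0 Omega (wpartial Omega 0 (fun x => d x 1 0)) chi.
  rewrite -(dot0Bl mOmega L10 L01 Lc); apply: eq_Rintegral => x _.
  by rewrite sym_dot_scalar !curlmxE.
have h10 := H1_H10_by_parts oOmega bOmega 1 (Hd 0) Hc.
have h01 := H1_H10_by_parts oOmega bOmega 0 (Hd 1) Hc.
rewrite [X in X - _]h10 [X in _ - X]h01 opprK {h10 h01}.
have bound i j : `|dot0 Omega (fun x => d x j 0) (wpartial Omega i chi)| <=
    normmx Omega d * seminorm1 Omega chi.
  apply: le_trans (cauchy_schwarz0 mOmega (H1_L2 (Hd j)) (wpartial_L2 i Hc1)) _.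
  apply: (ler_pM (norm0_ge0 _ _) (norm0_ge0 _ _)).
    by apply: (norm0_entry_le mOmega); exact: H1vec_L2mx.
  exact: norm0_wpartial_le.
have /ler_normlP[h1 _] := bound 1 0; have /ler_normlP[_ h2] := bound 0 1.
by apply: le_trans (lerD h1 h2) _; rewrite -mulrA mulr_natl mulr2n.
Qed.

Lemma RMrotP r : RMrot r -> exists a b c : R,
  (fun x => r x 0 0) = affine c 0 a /\ (fun x => r x 1 0) = affine 0 c b.
Proof.
move=> [a [b [c rE]]]; exists a, b, c; split; apply/funext => x;
  rewrite rE !mxE /affine /coord /=; ring.
Qed.

Lemma RMrot_H1vec r : RMrot r -> H1vec Omega r.
Proof.
move=> /RMrotP[a [b [c [r0 r1]]]] j; have [->|->] := ord2P j; rewrite ?r0 ?r1;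
  exact/Ck1_H1/Ck1_affine.
Qed.

(** The curl of an element of RM^rot is a constant skew matrix. *)
Lemma symcurl_RMrot r : RMrot r -> aeq Omega (symcurl Omega r) (fun=> 0).
Proof.
move=> /RMrotP[a [b [c [r0 r1]]]].
have wpE i a' b' c' : aeq Omega (wpartial Omega i (affine a' b' c'))
    (fun=> a' * (unitv R i).1 + b' * (unitv R i).2).
  have CE := Ck1_affine a' b' c'.
  rewrite (_ : (fun=> _) = partial i (affine a' b' c')).
    apply: wpartial_eq => //; first exact: Ck1_H1.
    exact: Ck1_weak_partial.
  by apply/funext => x; rewrite partial_affine.
near=> x; move=> Ox.
have wx i a' b' c' : (i, a', b', c') \in [:: (0, c, 0, a); (1, c, 0, a);
    (0, 0, c, b); (1, 0, c, b)] -> wpartial Omega i (affine a' b' c') x =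
    a' * (unitv R i).1 + b' * (unitv R i).2.
  rewrite !inE => /or4P[] /eqP[-> -> -> ->]; move: Ox; near: x; exact: wpE.
apply/matrixP => i j; rewrite !mxE.
have [->|->] := ord2P i; have [->|->] := ord2P j; rewrite /= ?mxE /= ?r0 ?r1;
  rewrite !wx ?inE ?eqxx ?orbT//= /unitv /=; ring.
Unshelve. all: by end_near.
Qed.

End symmetric_curl.

(** * Representatives modulo RM^rot *)

(* The arguments below are bilinear algebra: unification must not compare two
   fields by unfolding them down to pointwise expressions. *)
#[local] Opaque Defs.dotmx Defs.dot0 Defs.wpartial Defs.grad Defs.symcurl.

Section quotient.
Context {R : realType}.
Local Notation plane := (R * R)%type.
Local Notation mplane := (measurableTypeR R * measurableTypeR R)%type.
Variable Omega : set plane.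
Hypothesis oOmega : open Omega.
Hypothesis bOmega : bounded_set Omega.
Let mOmega : measurable (Omega : set mplane) := open_measurable_plane oOmega.

Definition closedDZ (U : lmodType R) (X : set (plane -> U)) :=
  forall (u v : plane -> U) (a : R), X u -> X v -> X (u + a *: v).

Lemma closedB (U : lmodType R) (X : set (plane -> U)) u v :
  closedDZ X -> X u -> X v -> X (u - v).
Proof. by move=> cX Xu Xv; rewrite -(scaleN1r v); exact: cX. Qed.

Lemma H10_closedDZ : closedDZ (H10 Omega).
Proof. by move=> u v a Hu Hv; exact: H10DZ. Qed.

Lemma H1vec_closedDZ : closedDZ (H1vec Omega).
Proof. by move=> p q a Hp Hq; exact: H1vecDZ. Qed.

Lemma fin_dim_sub (U : lmodType R) (X V : set (plane -> U)) :
  fin_dim_subspace Omega X V -> V `<=` X.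
Proof. by move=> [n [b [_ ->]]] v []. Qed.

Lemma fin_dim_closedDZ (U : lmodType R) (X V : set (plane -> U)) :
  closedDZ X -> fin_dim_subspace Omega X V -> closedDZ V.
Proof.
move=> cX [n [b [_ ->]]] u v c [Xu [a ua]] [Xv [a' va]]; split; first exact: cX.
exists (fun j => a j + c * a' j); move: ua va; apply: filterS2 => x ux vx Ox.
rewrite !fctE ux// vx// scaler_sumr -big_split; apply: eq_bigr => j _.
by rewrite scalerDl scalerA.
Qed.

Let good (K : set (plane -> 'cV[R]_2)) :=
  [/\ K `<=` L2mx Omega, closedDZ K & projectable Omega K].

Let good_addline K e : good K -> L2mx Omega e ->
  good [set G + a *: e | G in K & a in [set: R]].
Proof.
move=> [LK cK pK] Le; split.
- move=> _ [G KG [a _ <-]]; apply: (L2mxD mOmega (LK _ KG)).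
  exact (L2mxZ mOmega a Le).
- move=> _ _ c [G KG [a _ <-]] [H KH [b _ <-]].
  exists (G + c *: H); first exact: cK.
  by exists (a + c * b) => //; rewrite scalerDr scalerA scalerDl addrACA.
- exact: (projectable_addline mOmega LK (fun a G H => @cK G H a) Le pK).
Qed.

Lemma RMrot_projectable : projectable Omega (@RMrot R).
Proof.
have g0 : good [set 0].
  split.
  - by move=> _ ->; exact: L2mx0.
  - by move=> _ _ a -> ->; rewrite scaler0 addr0.
  - move=> F LF; exists 0 => // _ ->.
    by rewrite subr0 (dotmx0r mOmega LF).
have LRM r : RMrot r -> L2mx Omega r.
  by move=> /(RMrot_H1vec oOmega bOmega) /H1vec_L2mx.
pose e0 : plane -> 'cV[R]_2 := fun=> delta_mx 0 0.
pose e1 : plane -> 'cV[R]_2 := fun=> delta_mx 1 0.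
pose e2 : plane -> 'cV[R]_2 := fun x => \col_i coord i x.
have L0 : L2mx Omega e0.
  apply: LRM; exists 1, 0, 0; apply/funext => x.
  by rewrite scale1r !scale0r !addr0.
have L1 : L2mx Omega e1.
  apply: LRM; exists 0, 1, 0; apply/funext => x.
  by rewrite scale1r !scale0r add0r addr0.
have L2' : L2mx Omega e2.
  apply: LRM; exists 0, 0, 1; apply/funext => x.
  by rewrite scale1r !scale0r !add0r.
have [_ _] := good_addline (good_addline (good_addline g0 L0) L1) L2'.
congr projectable; apply/seteqP; split.
  move=> _ [_ [_ [_ -> [a _ <-]] [b _ <-]] [c _ <-]].
  by exists a, b, c; apply/funext => x; rewrite add0r.
move=> _ [a [b [c ->]]].
exists (0 + a *: e0 + b *: e1); last by exists c => //; rewrite add0r.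
exists (0 + a *: e0); last by exists b.
by exists 0 => //; exists a.
Qed.

(** The discrete equations are tested on the quotient, while the infimum ranges over
    all of P_h: subtracting the projection onto RM^rot, which sym curl does not see,
    reconciles the two. *)
Lemma quoRM_representative (P : set (plane -> 'cV[R]_2)) q :
  closedDZ P -> @RMrot R `<=` P -> P `<=` H1vec Omega -> P q ->
  exists q', quoRM Omega P q' /\ aeq Omega (symcurl Omega q') (symcurl Omega q).
Proof.
move=> cP RP PH Pq; have [r Rr qr] := RMrot_projectable (H1vec_L2mx (PH _ Pq)).
exists (q - r); split; first by split; [exact: closedB (RP _ Rr)|exact: qr].
have := symcurlB oOmega bOmega (PH _ Pq) (RMrot_H1vec oOmega bOmega Rr).
have := symcurl_RMrot oOmega bOmega Rr.
by apply: filterS2 => x r0 sE Ox; rewrite sE// !fctE r0// subr0.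
Qed.

Lemma quoRM_closedDZ (P : set (plane -> 'cV[R]_2)) :
  closedDZ P -> P `<=` H1vec Omega -> closedDZ (quoRM Omega P).
Proof.
move=> cP PH p q a [Pp op] [Pq oq]; split; first exact: cP.
move=> r Rr; have Lr := H1vec_L2mx (RMrot_H1vec oOmega bOmega Rr).
have Lp := H1vec_L2mx (PH _ Pp); have Lq := H1vec_L2mx (PH _ Pq).
rewrite (dotmxDl mOmega Lp (L2mxZ mOmega a Lq) Lr) (dotmxZl mOmega a Lq Lr).
by rewrite op// oq// mulr0 addr0.
Qed.

End quotient.

(** * Quasi-optimality of Galerkin approximations *)

Section galerkin.
Context {R : realType}.
Local Notation plane := (R * R)%type.
Local Notation mplane := (measurableTypeR R * measurableTypeR R)%type.
Variable Omega : set plane.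
Hypothesis mOmega : measurable (Omega : set mplane).

Lemma norm_le_of_sqr_le (x b : R) : 0 <= x -> 0 <= b -> x ^+ 2 <= b * x -> x <= b.
Proof.
rewrite le_eqVlt => /predU1P[<-//|x0] b0.
by rewrite expr2 ler_pM2r.
Qed.

(** The quasi-optimality argument of Cea and Strang: F is the exact field, D its
    approximation, G a competitor, and B bounds the consistency error, that is the
    residual F - D tested against G - D. The representatives G' and T come from
    choosing another potential for G and from differentiating a difference. *)
Lemma cea_strang m n (F D G G' T : plane -> 'M[R]_(m, n)) (B : R) :
  L2mx Omega F -> L2mx Omega D -> L2mx Omega G -> L2mx Omega G' -> L2mx Omega T ->
  aeq Omega G' G -> aeq Omega T (G' - D) -> 0 <= B ->
  dotmx Omega (F - D) T <= B * normmx Omega T ->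
  normmx Omega (F - D) <= 2 * normmx Omega (F - G) + B.
Proof.
move=> LF LD LG LG' LT GG' TE B0 cons.
have LFD := L2mxB mOmega LF LD; have LGD := L2mxB mOmega LG' LD.
have LGF := L2mxB mOmega LG' LF; have LFG := L2mxB mOmega LF LG'.
have -> : normmx Omega (F - G) = normmx Omega (F - G').
  apply: (normmx_aeq mOmega (L2mxB mOmega LF LG) LFG).
  by move: GG'; apply: filterS => x e Ox; rewrite !fctE e.
rewrite dotmxC (dotmx_aeq mOmega LT LGD LFD TE) dotmxC in cons.
rewrite (normmx_aeq mOmega LT LGD TE) in cons.
have GD : normmx Omega (G' - D) <= normmx Omega (F - G') + B.
  apply: norm_le_of_sqr_le; [exact: normmx_ge0|by rewrite addr_ge0 ?normmx_ge0|].
  rewrite normmx_sqr -[X in dotmx _ X _ <= _](subrKA F).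
  rewrite (dotmxDl mOmega LGF LFD LGD) mulrDl; apply: lerD cons.
  by rewrite (normmxBC Omega F G'); exact: dotmx_le.
rewrite -(subrKA G'); apply: le_trans (normmxD mOmega LFG LGD) _.
by rewrite mulr_natl mulr2n -addrA lerD2l.
Qed.

(** Superconvergence: the projection Z of F onto the discrete space differs from D
    by the consistency error alone. *)
Lemma projection_error m n (F D Z T : plane -> 'M[R]_(m, n)) (B : R) :
  L2mx Omega F -> L2mx Omega D -> L2mx Omega Z -> L2mx Omega T ->
  aeq Omega T (Z - D) -> 0 <= B ->
  dotmx Omega Z T = dotmx Omega F T ->
  dotmx Omega (F - D) T <= B * normmx Omega T ->
  normmx Omega T <= B.
Proof.
move=> LF LD LZ LT TE B0 ZF cons; have LZD := L2mxB mOmega LZ LD.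
apply: (norm_le_of_sqr_le (normmx_ge0 _ _) B0); rewrite normmx_sqr.
rewrite {1}(dotmx_aeq mOmega LT LZD LT TE) (dotmxBl mOmega LZ LD LT) ZF.
by rewrite -(dotmxBl mOmega LF LD LT).
Qed.

End galerkin.

(** * Error estimates on one mesh *)

Section error_estimates.
Context {R : realType}.
Local Notation plane := (R * R)%type.
Local Notation mplane := (measurableTypeR R * measurableTypeR R)%type.
Variable Omega : set plane.
Hypothesis oOmega : open Omega.
Hypothesis bOmega : bounded_set Omega.
Let mOmega : measurable (Omega : set mplane) := open_measurable_plane oOmega.

Variable CP : R.
Hypothesis CP_gt0 : 0 < CP.
Hypothesis poincareP :
  forall u, H10 Omega u -> norm0 Omega u <= CP * seminorm1 Omega u.

Variables (f : plane -> R) (V : set (plane -> R)) (P : set (plane -> 'cV[R]_2)).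
Variables (w u wh uh : plane -> R) (p ph : plane -> 'cV[R]_2).
Hypothesis VH : V `<=` H10 Omega.
Hypothesis cV : closedDZ V.
Hypothesis PH : P `<=` H1vec Omega.
Hypothesis cP : closedDZ P.
Hypothesis RP : @RMrot R `<=` P.
Hypothesis sol : HHJ_solution Omega f (H10 Omega) (H1vec Omega) w p u.
Hypothesis solh : HHJ_solution Omega f V P wh ph uh.

Let Hw : H10 Omega w. Proof. by case: sol => -[]. Qed.
Let Hu : H10 Omega u. Proof. by case: sol => -[]. Qed.
Let Hp : H1vec Omega p. Proof. by case: sol => -[_ []]. Qed.
Let Vwh : V wh. Proof. by case: solh => -[]. Qed.
Let Vuh : V uh. Proof. by case: solh => -[]. Qed.
Let Qph : quoRM Omega P ph. Proof. by case: solh => -[]. Qed.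
Let Pph : P ph. Proof. by case: Qph. Qed.
Let Hph : H1vec Omega ph. Proof. exact: PH. Qed.
Let Gw := grad_L2mx (H10_H1 Hw).
Let Gwh := grad_L2mx (H10_H1 (VH Vwh)).
Let Gu := grad_L2mx (H10_H1 Hu).
Let Guh := grad_L2mx (H10_H1 (VH Vuh)).
Let Sp := symcurl_L2mx oOmega Hp.
Let Sph := symcurl_L2mx oOmega Hph.
Let Lw := H1_L2 (H10_H1 Hw).
Let Lwh := H1_L2 (H10_H1 (VH Vwh)).
Let Lpiw := pimx_L2mx oOmega Lw.
Let Lpiwh := pimx_L2mx oOmega Lwh.
Let H10_ww : H10 Omega (w - wh).
Proof. exact: closedB (H10_closedDZ oOmega bOmega) Hw (VH Vwh). Qed.
Let Lww := H1_L2 (H10_H1 H10_ww).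
Let Lpiww : L2mx Omega (pimx w - pimx wh).
Proof. exact (L2mxB mOmega Lpiw Lpiwh). Qed.

(** Conformity: discrete test functions are admissible in the continuous equation, and
    the data cancels. *)
Lemma eq_w v : V v ->
  dotmx Omega (grad Omega w - grad Omega wh) (grad Omega v) = 0.
Proof.
move=> Vv; have Gv := grad_L2mx (H10_H1 (VH Vv)).
have [_ [ew _ _]] := sol; have [_ [ewh _ _]] := solh.
rewrite (dotmxBl mOmega Gw Gwh Gv); apply/eqP; rewrite subr_eq0; apply/eqP.
exact: etrans (ew _ (VH Vv)) (esym (ewh _ Vv)).
Qed.

(** The two equations for p differ by their data, so that Galerkin orthogonality fails
    by the error on w. *)
Lemma eq_p q : quoRM Omega P q ->
  dotmx Omega (symcurl Omega p - symcurl Omega ph) (symcurl Omega q) =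
  - dotmx Omega (pimx w - pimx wh) (symcurl Omega q).
Proof.
move=> Qq; have Sq := symcurl_L2mx oOmega (PH Qq.1).
have [_ [_ ep _]] := sol; have [_ [_ eph _]] := solh.
rewrite (dotmxBl mOmega Sp Sph Sq) (dotmxBl mOmega Lpiw Lpiwh Sq).
have Qq' : quoRM Omega (H1vec Omega) q by split; [exact: PH Qq.1|exact: Qq.2].
have oppB (a b c d : R) : a = - c -> b = - d -> a - b = - (c - d).
  by move=> -> ->; rewrite opprB opprK addrC.
exact: oppB (ep _ Qq') (eph _ Qq).
Qed.

Lemma eq_u chi : V chi ->
  dotmx Omega (grad Omega u - grad Omega uh) (grad Omega chi) =
  dotmx Omega (sigma Omega p w - sigma Omega ph wh) (pimx chi).
Proof.
move=> Vc; have Hc := VH Vc; have Gc := grad_L2mx (H10_H1 Hc).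
have Lc := pimx_L2mx oOmega (H1_L2 (H10_H1 Hc)).
have [_ [_ _ eu]] := sol; have [_ [_ _ euh]] := solh.
rewrite (dotmxBl mOmega Gu Guh Gc) (eu _ Hc) (euh _ Vc).
have Ls := sigma_L2mx oOmega Hp Lw; have Lsh := sigma_L2mx oOmega Hph Lwh.
by rewrite (dotmxBl mOmega Ls Lsh Lc).
Qed.

Lemma gradB_V v v' : V v -> V v' ->
  aeq Omega (grad Omega (v - v')) (grad Omega v - grad Omega v').
Proof.
move=> /VH/H10_H1 Hv /VH/H10_H1 Hv'.
rewrite -(scaleN1r v') -(scaleN1r (grad Omega v')); exact: gradDZ.
Qed.

Lemma estimate_w v : V v ->
  seminorm1 Omega (w - wh) <= 2 * seminorm1 Omega (w - v).
Proof.
move=> Vv; have Hv := H10_H1 (VH Vv); have Hwh := H10_H1 (VH Vwh).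
have Gv := grad_L2mx Hv; have Vd := closedB cV Vv Vwh.
have Gd := grad_L2mx (H10_H1 (VH Vd)).
rewrite (seminorm1B oOmega bOmega (H10_H1 Hw) Hwh).
rewrite (seminorm1B oOmega bOmega (H10_H1 Hw) Hv) -[leRHS]addr0.
apply: (cea_strang mOmega Gw Gwh Gv Gv Gd (aeq_refl _ _) (gradB_V Vv Vwh) (lexx 0)).
by rewrite mul0r (eq_w Vd).
Qed.

Lemma norm_pimx_ww : normmx Omega (pimx w - pimx wh) <= 2 * norm0 Omega (w - wh).
Proof. by rewrite -pimxB; exact: normmx_pimx_le. Qed.

Lemma estimate_w0 v : V v ->
  norm0 Omega (w - wh) <= 2 * CP * seminorm1 Omega (w - v).
Proof.
move=> Vv; apply: le_trans (poincareP H10_ww) _.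
by rewrite (mulrC 2) -mulrA ler_pM2l//; exact: estimate_w.
Qed.

Lemma residual_p_le q : quoRM Omega P q ->
  dotmx Omega (symcurl Omega p - symcurl Omega ph) (symcurl Omega q) <=
  2 * norm0 Omega (w - wh) * normmx Omega (symcurl Omega q).
Proof.
move=> Qq; have Sq := symcurl_L2mx oOmega (PH Qq.1).
apply: le_trans (ler_norm _) _; rewrite (eq_p Qq) normrN.
apply: le_trans (cauchy_schwarz mOmega Lpiww Sq) _.
by apply: (ler_wpM2r (normmx_ge0 _ _)); exact: norm_pimx_ww.
Qed.

Lemma estimate_p q : P q ->
  normmx Omega (symcurl Omega p - symcurl Omega ph) <=
  2 * normmx Omega (symcurl Omega p - symcurl Omega q) + 2 * norm0 Omega (w - wh).
Proof.
move=> Pq; have [q' [Qq' qq']] := quoRM_representative oOmega bOmega cP RP PH Pq.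
have Hq' := PH Qq'.1; have Sq' := symcurl_L2mx oOmega Hq'.
have Sq := symcurl_L2mx oOmega (PH Pq).
have Qd := closedB (quoRM_closedDZ oOmega bOmega cP PH) Qq' Qph.
have Sd := symcurl_L2mx oOmega (PH Qd.1).
apply: (cea_strang mOmega Sp Sph Sq Sq' Sd qq' (symcurlB oOmega bOmega Hq' Hph)).
  by rewrite mulr_ge0 ?norm0_ge0.
exact: residual_p_le.
Qed.

Lemma estimate_sigma :
  normmx Omega (sigma Omega p w - sigma Omega ph wh) <=
  normmx Omega (symcurl Omega p - symcurl Omega ph) + 2 * norm0 Omega (w - wh).
Proof.
rewrite /sigma opprD addrACA.
apply: le_trans (normmxD mOmega (L2mxB mOmega Sp Sph) Lpiww) _.
by rewrite lerD2l; exact: norm_pimx_ww.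
Qed.

Let Ls : L2mx Omega (sigma Omega p w - sigma Omega ph wh).
Proof.
exact (L2mxB mOmega (sigma_L2mx oOmega Hp Lw) (sigma_L2mx oOmega Hph Lwh)).
Qed.

Lemma estimate_u v : V v ->
  seminorm1 Omega (u - uh) <= 2 * seminorm1 Omega (u - v) +
    2 * CP * normmx Omega (sigma Omega p w - sigma Omega ph wh).
Proof.
move=> Vv; have Hv := H10_H1 (VH Vv); have Huh := H10_H1 (VH Vuh).
have Gv := grad_L2mx Hv; have Vd := closedB cV Vv Vuh.
have Gd := grad_L2mx (H10_H1 (VH Vd)); have Ld := H1_L2 (H10_H1 (VH Vd)).
rewrite (seminorm1B oOmega bOmega (H10_H1 Hu) Huh).
rewrite (seminorm1B oOmega bOmega (H10_H1 Hu) Hv).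
apply: (cea_strang mOmega Gu Guh Gv Gv Gd (aeq_refl _ _) (gradB_V Vv Vuh)).
  by rewrite !mulr_ge0 ?normmx_ge0// ltW.
rewrite (eq_u Vd).
apply: le_trans (dotmx_le mOmega Ls (pimx_L2mx oOmega Ld)) _.
rewrite mulrC [leRHS]mulrAC; apply: (ler_wpM2r (normmx_ge0 _ _)).
apply: le_trans (normmx_pimx_le oOmega Ld) _.
by rewrite -mulrA ler_pM2l//; exact: poincareP (VH Vd).
Qed.

Lemma estimate_Pcs r : is_Pcs Omega P p r ->
  normmx Omega (symcurl Omega (r - ph)) <= 2 * norm0 Omega (w - wh).
Proof.
move=> [Qr er]; have Hr := PH Qr.1; have Sr := symcurl_L2mx oOmega Hr.
have Qd := closedB (quoRM_closedDZ oOmega bOmega cP PH) Qr Qph.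
have Sd := symcurl_L2mx oOmega (PH Qd.1).
have dE := symcurlB oOmega bOmega Hr Hph.
apply: (projection_error mOmega Sp Sph Sr Sd dE).
- by rewrite mulr_ge0 ?norm0_ge0.
- exact: er.
- exact: residual_p_le.
Qed.

(** The residual sigma - sigma_h splits into sym curl (p - p_h), whose pairing with
    pi chi only costs the L^2 norm of p - p_h after integration by parts, and
    pi (w - w_h), which only costs the L^2 norm of w - w_h. *)
Lemma estimate_Pgrad z : is_Pgrad Omega V u z ->
  seminorm1 Omega (z - uh) <=
  2 * normmx Omega (p - ph) + 4 * CP * norm0 Omega (w - wh).
Proof.
move=> [Vz ez]; have Hz := H10_H1 (VH Vz); have Huh := H10_H1 (VH Vuh).
have Vd := closedB cV Vz Vuh; have Hd := VH Vd.
have Gz := grad_L2mx Hz; have Gd := grad_L2mx (H10_H1 Hd).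
have Ld := H1_L2 (H10_H1 Hd); have Lpid := pimx_L2mx oOmega Ld.
have Hpp := H1vecB oOmega bOmega Hp Hph; have Spp := symcurl_L2mx oOmega Hpp.
have SB := L2mxB mOmega Sp Sph.
apply: (projection_error mOmega Gu Guh Gz Gd (gradB_V Vz Vuh)).
- by rewrite addr_ge0// !mulr_ge0 ?normmx_ge0 ?norm0_ge0// ltW.
- exact: ez.
rewrite (eq_u Vd) /sigma opprD addrACA (dotmxDl mOmega SB Lpiww Lpid) mulrDl.
apply: lerD.
  have <- := dotmx_aeq mOmega Spp SB Lpid (symcurlB oOmega bOmega Hp Hph).
  exact: symcurl_pimx_le.
apply: le_trans (dotmx_le mOmega Lpiww Lpid) _.
apply: le_trans (ler_pM (normmx_ge0 _ _) (normmx_ge0 _ _) norm_pimx_ww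
  (normmx_pimx_le oOmega Ld)) _.
have arith (a b c : R) : b <= CP * c -> 0 <= a -> 2 * a * (2 * b) <= 4 * CP * a * c.
  move=> bc a0; rewrite (_ : 2 * a * (2 * b) = 4 * a * b); last by ring.
  rewrite (_ : 4 * CP * a * c = 4 * a * (CP * c)); last by ring.
  by apply: ler_wpM2l bc; rewrite mulr_ge0.
exact: arith (poincareP Hd) (norm0_ge0 _ _).
Qed.

Let symE q : P q -> normmx Omega (symcurl Omega (p - q)) =
  normmx Omega (symcurl Omega p - symcurl Omega q).
Proof. move=> Pq. exact (normmx_symcurlB oOmega bOmega Hp (PH Pq)). Qed.

Let two_gt0 : 0 < 2 :> R. Proof. by []. Qed.

Lemma quasi_optimal_p q v : P q -> V v ->
  normmx Omega (symcurl Omega (p - ph)) <=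
  2 * normmx Omega (symcurl Omega (p - q)) + 4 * CP * seminorm1 Omega (w - v).
Proof.
move=> Pq Vv; rewrite [X in X <= _](symE Pph) [X in 2 * X + _](symE Pq).
apply: le_trans (estimate_p Pq) _.
have -> : 4 * CP * seminorm1 Omega (w - v) =
    2 * (2 * CP * seminorm1 Omega (w - v)) by ring.
by rewrite lerD2l (ler_pM2l two_gt0); exact: estimate_w0.
Qed.

Lemma quasi_optimal_sigma q v : P q -> V v ->
  normmx Omega (sigma Omega p w - sigma Omega ph wh) <=
  2 * normmx Omega (symcurl Omega (p - q)) + 8 * CP * seminorm1 Omega (w - v).
Proof.
move=> Pq Vv; apply: le_trans estimate_sigma _; rewrite -[X in X + _ <= _](symE Pph).
have -> : 8 * CP * seminorm1 Omega (w - v) = 4 * CP * seminorm1 Omega (w - v) +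
    2 * (2 * CP * seminorm1 Omega (w - v)) by ring.
rewrite addrA; apply: lerD; first exact: quasi_optimal_p.
by rewrite (ler_pM2l two_gt0); exact: estimate_w0.
Qed.

Lemma quasi_optimal_u v' q v : V v' -> P q -> V v ->
  seminorm1 Omega (u - uh) <= 2 * seminorm1 Omega (u - v') +
    (4 * CP * normmx Omega (symcurl Omega (p - q))
     + 16 * CP ^+ 2 * seminorm1 Omega (w - v)).
Proof.
move=> Vv' Pq Vv; apply: le_trans (estimate_u Vv') _; rewrite lerD2l.
have C0 : 0 < 2 * CP by rewrite mulr_gt0.
apply: (@le_trans _ _ (2 * CP * (2 * normmx Omega (symcurl Omega (p - q))
    + 8 * CP * seminorm1 Omega (w - v)))).
  by rewrite (ler_pM2l C0); exact: quasi_optimal_sigma.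
by rewrite le_eqVlt; apply/orP; left; apply/eqP; ring.
Qed.

(* The L^2 error bounds of the last part of the theorem, with eta the power of h. *)
Variables (C0 eta : R).
Hypothesis C0_gt0 : 0 < C0.
Hypothesis eta_ge0 : 0 <= eta.
Hypothesis duality_w :
  norm0 Omega (w - wh) <= C0 * (eta * seminorm1 Omega (w - wh)).

Lemma superconvergent_w v : V v ->
  norm0 Omega (w - wh) <= C0 * (eta * (2 * seminorm1 Omega (w - v))).
Proof.
move=> Vv; apply: le_trans duality_w _; rewrite (ler_pM2l C0_gt0).
by apply: (ler_wpM2l eta_ge0); exact: estimate_w.
Qed.

Lemma superconvergent_p r v : is_Pcs Omega P p r -> V v ->
  normmx Omega (symcurl Omega (r - ph)) +
    normmx Omega (sigma Omega r wh - sigma Omega ph wh) <=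
  8 * C0 * eta * seminorm1 Omega (w - v).
Proof.
move=> Pr Vv; have Hr := PH Pr.1.1.
have -> : sigma Omega r wh - sigma Omega ph wh =
    symcurl Omega r - symcurl Omega ph.
  have cancel (A B C : plane -> 'M[R]_2) : (A + C) - (B + C) = A - B.
    by rewrite opprD addrACA subrr addr0.
  exact: cancel.
rewrite -(normmx_symcurlB oOmega bOmega Hr Hph).
apply: le_trans (lerD (estimate_Pcs Pr) (estimate_Pcs Pr)) _.
have -> : 8 * C0 * eta * seminorm1 Omega (w - v) =
    2 * (C0 * (eta * (2 * seminorm1 Omega (w - v))))
    + 2 * (C0 * (eta * (2 * seminorm1 Omega (w - v)))) by ring.
by apply: lerD; rewrite (ler_pM2l two_gt0); exact: superconvergent_w.
Qed.

Hypothesis duality_p :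
  normmx Omega (p - ph) <= C0 * (eta * normmx Omega (symcurl Omega (p - ph))).

Lemma superconvergent_u z q v : is_Pgrad Omega V u z -> P q -> V v ->
  seminorm1 Omega (z - uh) <=
  C0 * eta * (4 * normmx Omega (symcurl Omega (p - q))
              + 16 * CP * seminorm1 Omega (w - v)).
Proof.
move=> Pz Pq Vv; apply: le_trans (estimate_Pgrad Pz) _.
have hp : normmx Omega (p - ph) <= C0 * (eta *
    (2 * normmx Omega (symcurl Omega (p - q)) + 4 * CP * seminorm1 Omega (w - v))).
  apply: le_trans duality_p _; rewrite (ler_pM2l C0_gt0).
  by apply: (ler_wpM2l eta_ge0); exact: quasi_optimal_p.
have arith (x y a b : R) :
    x <= C0 * (eta * (2 * a + 4 * CP * b)) -> y <= C0 * (eta * (2 * b)) ->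
    2 * x + 4 * CP * y <= C0 * eta * (4 * a + 16 * CP * b).
  move=> hx hy.
  have -> : C0 * eta * (4 * a + 16 * CP * b) =
      2 * (C0 * (eta * (2 * a + 4 * CP * b)))
      + 4 * CP * (C0 * (eta * (2 * b))) by ring.
  by apply: lerD; rewrite ler_pM2l// mulr_gt0.
exact: arith hp (superconvergent_w Vv).
Qed.

End error_estimates.

(** * Infima over the discrete spaces *)

Section infimum.
Context {R : realType}.

Lemma le_mul_inf (T : Type) (A : set T) (g : T -> R) (x y C : R) :
  A !=set0 -> 0 < C -> (forall t, A t -> x <= C * (y + g t)) ->
  x <= C * (y + inf [set g t | t in A]).
Proof.
move=> [t0 At0] C0 h; rewrite -ler_pdivrMl// -lerBlDl; apply: lb_le_inf.
  by exists (g t0); exists t0.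
by move=> _ [t At <-]; rewrite lerBlDl ler_pdivrMl//; exact: h.
Qed.

Lemma le_mul_inf2 (S T : Type) (A : set S) (B : set T) (f : S -> R) (g : T -> R)
    (x y C : R) :
  A !=set0 -> B !=set0 -> 0 < C ->
  (forall s t, A s -> B t -> x <= C * (y + f s + g t)) ->
  x <= C * (y + inf [set f s | s in A] + inf [set g t | t in B]).
Proof.
move=> A0 B0 C0 h; apply: le_mul_inf => // t Bt.
rewrite addrAC; apply: le_mul_inf => // s As.
by rewrite addrAC; exact: h.
Qed.

Lemma le_scale_inf (T : Type) (A : set T) (g : T -> R) (x C eta : R) :
  A !=set0 -> 0 < C -> 0 < eta -> (forall t, A t -> x <= C * (eta * g t)) ->
  x <= C * (eta * inf [set g t | t in A]).
Proof.
move=> A0 C0 eta0 h; rewrite mulrA -[X in _ <= _ * X]add0r.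
by apply: le_mul_inf => [//||t At]; [rewrite mulr_gt0|rewrite add0r -mulrA; exact: h].
Qed.

Lemma le_scale_inf2 (S T : Type) (A : set S) (B : set T) (f : S -> R) (g : T -> R)
    (x C eta : R) :
  A !=set0 -> B !=set0 -> 0 < C -> 0 < eta ->
  (forall s t, A s -> B t -> x <= C * (eta * f s + eta * g t)) ->
  x <= C * (eta * inf [set f s | s in A] + eta * inf [set g t | t in B]).
Proof.
move=> A0 B0 C0 eta0 h; rewrite -mulrDr mulrA -[X in _ <= _ * (X + _)]add0r.
apply: le_mul_inf2 => [//|//||s t As Bt]; first by rewrite mulr_gt0.
by rewrite add0r -mulrA mulrDr; exact: h.
Qed.

Lemma le_common_factor (a b A B C : R) : 0 <= a -> 0 <= b -> A <= C -> B <= C ->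
  A * a + B * b <= C * (a + b).
Proof.
by move=> a0 b0 AC BC; rewrite mulrDr; apply: lerD; apply: ler_wpM2r.
Qed.

End infimum.

Theorem theorem4p2 (R : realType) (Omega : set (R * R))
  (lipOmega : bounded_lipschitz_domain Omega)
  (scOmega : simply_connected Omega)
  (bdOmega : connected (boundary Omega)) :
  (exists C : R, 0 < C /\
    forall (f : R * R -> R) (I : Type) (h : I -> R)
      (V : I -> set (R * R -> R)) (P : I -> set (R * R -> 'cV[R]_2))
      (w : R * R -> R) (p : R * R -> 'cV[R]_2) (u : R * R -> R)
      (wh : I -> R * R -> R) (ph : I -> R * R -> 'cV[R]_2)
      (uh : I -> R * R -> R),
    L2 Omega f ->
    fe_spaces Omega h V P ->
    HHJ_solution Omega f (H10 Omega) (H1vec Omega) w p u ->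
    (forall i, HHJ_solution Omega f (V i) (P i) (wh i) (ph i) (uh i)) ->
    forall i,
      normmx Omega (symcurl Omega (p - ph i))
        + normmx Omega (sigma Omega p w - sigma Omega (ph i) (wh i))
      <= C * (inf [set normmx Omega (symcurl Omega (p - q)) | q in P i]
              + inf [set seminorm1 Omega (w - v) | v in V i])
      /\
      seminorm1 Omega (u - uh i)
      <= C * (inf [set seminorm1 Omega (u - v) | v in V i]
              + inf [set normmx Omega (symcurl Omega (p - q)) | q in P i]
              + inf [set seminorm1 Omega (w - v) | v in V i]))
  /\
  (forall delta C0 : R, 2^-1 < delta <= 1 -> 0 < C0 ->
   exists C : R, 0 < C /\
    forall (f : R * R -> R) (I : Type) (h : I -> R)
      (V : I -> set (R * R -> R)) (P : I -> set (R * R -> 'cV[R]_2))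
      (w : R * R -> R) (p : R * R -> 'cV[R]_2) (u : R * R -> R)
      (wh : I -> R * R -> R) (ph : I -> R * R -> 'cV[R]_2)
      (uh : I -> R * R -> R),
    L2 Omega f ->
    fe_spaces Omega h V P ->
    HHJ_solution Omega f (H10 Omega) (H1vec Omega) w p u ->
    (forall i, HHJ_solution Omega f (V i) (P i) (wh i) (ph i) (uh i)) ->
    (forall i, norm0 Omega (w - wh i)
               <= C0 * (h i `^ delta * seminorm1 Omega (w - wh i))) ->
    (forall i, normmx Omega (p - ph i)
               <= C0 * (h i `^ delta
                        * normmx Omega (symcurl Omega (p - ph i)))) ->
    forall i (Pcs_p : R * R -> 'cV[R]_2) (Pgrad_u : R * R -> R),
      is_Pcs Omega (P i) p Pcs_p ->
      is_Pgrad Omega (V i) u Pgrad_u ->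
      normmx Omega (symcurl Omega (Pcs_p - ph i))
        + normmx Omega (sigma Omega Pcs_p (wh i)
                        - sigma Omega (ph i) (wh i))
      <= C * (h i `^ delta * inf [set seminorm1 Omega (w - v) | v in V i])
      /\
      seminorm1 Omega (Pgrad_u - uh i)
      <= C * (h i `^ delta
                * inf [set normmx Omega (symcurl Omega (p - q)) | q in P i]
              + h i `^ delta * inf [set seminorm1 Omega (w - v) | v in V i])).
Proof.
have [_ oO _ bO _] := lipOmega.
have [CP CP0 poin] := poincare oO bO.
split.
  (* A common bound for the constants 4 and 12 CP of the first estimate, and 2, 4 CP
     and 16 CP^2 of the second one. *)
  exists ((2 + 4 * CP) ^+ 2).
  have C0 : 0 < (2 + 4 * CP) ^+ 2 by rewrite exprn_gt0// addr_gt0// mulr_gt0.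
  have C4 : 4 <= (2 + 4 * CP) ^+ 2 by nra.
  have C2 : 2 <= (2 + 4 * CP) ^+ 2 by nra.
  have C12 : 12 * CP <= (2 + 4 * CP) ^+ 2 by nra.
  have C4P : 4 * CP <= (2 + 4 * CP) ^+ 2 by nra.
  have C16 : 16 * CP ^+ 2 <= (2 + 4 * CP) ^+ 2 by nra.
  split=> // f I h V P w p u wh ph uh _ fe sol solh i.
  have [_ fV fP RP] := fe i.
  have VH := fin_dim_sub fV; have PH := fin_dim_sub fP.
  have cV := fin_dim_closedDZ (H10_closedDZ oO bO) fV.
  have cP := fin_dim_closedDZ (H1vec_closedDZ oO bO) fP.
  have [[Vwh [Pph _] _] _] := solh i.
  have P0 : P i !=set0 by exists (ph i).
  have V0 : V i !=set0 by exists (wh i).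
  split.
    rewrite -[X in _ * (X + _)]add0r; apply: le_mul_inf2 => // q v Pq Vv.
    have ep := quasi_optimal_p oO bO CP0 poin VH cV PH cP RP sol (solh i) Pq Vv.
    have es := quasi_optimal_sigma oO bO CP0 poin VH cV PH cP RP sol (solh i) Pq Vv.
    apply: le_trans (lerD ep es) _; rewrite add0r.
    have collect (a b : R) : 2 * a + 4 * CP * b + (2 * a + 8 * CP * b) =
        4 * a + 12 * CP * b by ring.
    rewrite collect.
    exact: le_common_factor (normmx_ge0 _ _) (seminorm1_ge0 _ _) C4 C12.
  apply: le_mul_inf2 => // q v Pq Vv.
  rewrite -[X in _ <= _ * X]addrA [X in _ <= _ * X]addrC.
  apply: le_mul_inf => // v' Vv'.
  have eu := quasi_optimal_u oO bO CP0 poin VH cV PH cP RP sol (solh i) Vv' Pq Vv.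
  apply: le_trans eu _; rewrite [X in _ <= _ * X]addrC [leRHS]mulrDr; apply: lerD.
    exact: ler_wpM2r (seminorm1_ge0 _ _) _ _ C2.
  exact: le_common_factor (normmx_ge0 _ _) (seminorm1_ge0 _ _) C4P C16.
move=> delta C0 _ C00; exists (C0 * (8 + 16 * CP)).
have C1 : 0 < C0 * (8 + 16 * CP) by rewrite mulr_gt0// addr_gt0// mulr_gt0.
have K4 : 4 <= 8 + 16 * CP by lra.
have K16 : 16 * CP <= 8 + 16 * CP by lra.
have K8 : 8 <= 8 + 16 * CP by lra.
split=> // f I h V P w p u wh ph uh _ fe sol solh dw dp i r z Pr Pz.
have [h0 fV fP RP] := fe i.
have VH := fin_dim_sub fV; have PH := fin_dim_sub fP.
have cV := fin_dim_closedDZ (H10_closedDZ oO bO) fV.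
have cP := fin_dim_closedDZ (H1vec_closedDZ oO bO) fP.
have [[Vwh [Pph _] _] _] := solh i.
have P0 : P i !=set0 by exists (ph i).
have V0 : V i !=set0 by exists (wh i).
have eta0 : 0 < h i `^ delta by exact: powR_gt0.
have dwi := dw i; have dpi := dp i.
move: eta0 dwi dpi; set eta := h i `^ delta => eta0 dwi dpi.
split.
  apply: (le_scale_inf V0 C1 eta0) => v Vv.
  have e := superconvergent_p oO bO VH cV PH cP sol (solh i) C00 (ltW eta0) dwi Pr Vv.
  apply: le_trans e _.
  have scale (s : R) : 0 <= s -> 8 * C0 * eta * s <= C0 * (8 + 16 * CP) * (eta * s).
    move=> s0; rewrite mulrA; apply: (ler_wpM2r s0); rewrite (ler_pM2r eta0).
    by rewrite mulrC (ler_pM2l C00).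
  exact: scale (seminorm1_ge0 _ _).
apply: (le_scale_inf2 P0 V0 C1 eta0) => q v Pq Vv.
have e := superconvergent_u oO bO CP0 poin VH cV PH cP RP sol (solh i) C00
  (ltW eta0) dwi dpi Pz Pq Vv.
apply: le_trans e _.
have scale (a b : R) : 0 <= a -> 0 <= b -> C0 * eta * (4 * a + 16 * CP * b) <=
    C0 * (8 + 16 * CP) * (eta * a + eta * b).
  move=> a0 b0; have -> : C0 * (8 + 16 * CP) * (eta * a + eta * b) =
    C0 * eta * ((8 + 16 * CP) * (a + b)) by ring.
  apply: ler_wpM2l; first by rewrite mulr_ge0 ?ltW.
  exact: le_common_factor.
exact: scale (normmx_ge0 _ _) (seminorm1_ge0 _ _).
Qed.
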